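(* Let $M$ be a separable $\mathrm{II}_1$ factor. Then $$\mathcal G(M)=\lim_{k\to\infty}\frac{\mathcal G^{\min}(M_{1/k})}{k^2}\qquad\text{and}\qquad \mathcal G_{\mathrm{sa}}(M)=\lim_{k\to\infty}\frac{\mathcal G_{\mathrm{sa}}^{\min}(M_{1/k})}{k^2}.$$
   Context: For a $\mathrm{II}_1$ factor $M$ with its faithful normal trace $\tau$, $\tau(1)=1$, let $\mathcal P(M)$ be the collection of all finite sets of mutually orthogonal projections in $M$ which sum to $1$. For $x\in M$ and $P\in\mathcal P(M)$ put $\mathcal I(x;P)=\sum_{p,q\in P,\ pxq\neq 0}\tau(p)\tau(q)$. For a finite subset $X\subset M$ put $\mathcal I(X;P)=\sum_{x\in X}\mathcal I(x;P)$ and $\mathcal I(X)=\inf_{P\in\mathcal P(M)}\mathcal I(X;P)$. $W^*(X)$ denotes the von Neumann algebra generated by $X$ (not automatically assumed to contain the identity of $M$). Define $\mathcal G(M)=\inf\{\mathcal I(X): X\subset M\text{ finite},\ W^*(X)=M\}$ and $\mathcal G_{\mathrm{sa}}(M)=\inf\{\mathcal I(X): X\subset M_{\mathrm{sa}}\text{ finite},\ W^*(X)=M\}$ (with $M_{\mathrm{sa}}$ the self-adjoint elements of $M$); both are $\infty$ if $M$ is not finitely generated. $\mathcal G^{\min}(M)$ is the minimal number of elements of $M$ generating $M$ as a von Neumann algebra, and $\mathcal G^{\min}_{\mathrm{sa}}(M)$ is the minimal number of self-adjoint elements generating $M$; both are $\infty$ if $M$ is not finitely generated. For $k\in\mathbb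 N$, $M_{1/k}$ denotes the $\mathrm{II}_1$ factor $pMp$, where $p\in M$ is a projection with $\tau(p)=1/k$ (unique up to isomorphism). *)

(* Defs.v *)
From HB Require Import structures.
From mathcomp Require Import all_boot all_order all_algebra.
From mathcomp Require Import finmap complex sesquilinear.
From mathcomp Require Import all_classical all_reals all_analysis.

Set Implicit Arguments.
Unset Strict Implicit.
Unset Printing Implicit Defensive.

Import Order.TTheory GRing.Theory Num.Theory.
Import numFieldNormedType.Exports.

Local Open Scope classical_set_scope.
Local Open Scope ring_scope.
Local Open Scope complex_scope.

Section VonNeumann.
Context {R : realType} {H : completeNormedModType R[i]}.
Context (ip : {dot H for (@Num.conj R[i])}).

Implicit Types (x y z p q e T : H -> H) (M N S : set (H -> H)).
Implicit Types (phi tau : (H -> H) -> R[i]) (X P : {fset (H -> H)}).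

Definition bounded_op : set (H -> H) := [set x | linear x /\ continuous x].

Definition is_adjoint x y : Prop := forall u v, ip (x u) v = ip u (y v).

Definition wot_closure S : set (H -> H) :=
  [set T | bounded_op T /\
    forall (s : seq (H * H)) (eps : R[i]), 0 < eps ->
      exists2 x, S x & forall uv, uv \in s -> `|ip (T uv.1 - x uv.1) uv.2| < eps].

(* The unit of [M], if any, need not be the identity operator of [H]. *)
Record vN_algebra M : Prop := {
  vN_bounded : M `<=` bounded_op ;
  vN_zero : M (fun=> 0) ;
  vN_add : forall x y, M x -> M y -> M (x \+ y) ;
  vN_scale : forall (a : R[i]) x, M x -> M (a \*: x) ;
  vN_mul : forall x y, M x -> M y -> M (x \o y) ;
  vN_adj : forall x, M x -> exists2 y, M y & is_adjoint x y ;
  vN_closed : wot_closure M `<=` M }.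

Definition W_star S : set (H -> H) :=
  \bigcap_(N in [set N | vN_algebra N /\ S `<=` N]) N.

Definition projection p : Prop := [/\ bounded_op p, p \o p = p & is_adjoint p p].

Definition abelian_projection M e : Prop :=
  [/\ M e, projection e &
    forall x y, M x -> M y ->
      (e \o x \o e) \o (e \o y \o e) = (e \o y \o e) \o (e \o x \o e)].

(* Murray--von Neumann types: type II (no nonzero abelian projection) and
   finite (every isometry of [M] is unitary). *)
Record II1_factor M : Prop := {
  II1_vN : vN_algebra M ;
  II1_unit : M idfun ;
  II1_nontrivial : (idfun : H -> H) <> (fun=> 0) ;
  II1_factorial : forall z, M z -> (forall x, M x -> z \o x = x \o z) ->
    exists a : R[i], z = a \*: idfun ;
  II1_no_abelian : forall e, abelian_projection M e -> e = (fun=> 0) ;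
  II1_finite : forall x y, M x -> M y -> is_adjoint x y ->
    y \o x = idfun -> x \o y = idfun }.

(* The elements of the predual: [phi] is on [M] the sum of a series of vector
   functionals given by two square-summable sequences of vectors. *)
Definition normal_functional M phi : Prop :=
  exists xi eta : nat -> H,
    [/\ cvgn (series (fun n => `|xi n| ^+ 2) : nat -> R[i]^o),
        cvgn (series (fun n => `|eta n| ^+ 2) : nat -> R[i]^o) &
        forall x, M x ->
          (series (fun n => ip (x (xi n)) (eta n)) : nat -> R[i]^o) @ \oo -->
            (phi x : R[i]^o)].

(* Countable dense subset of the predual for the norm dual to the operator
   norm. *)
Definition separable_predual M : Prop :=
  exists phi_ : nat -> (H -> H) -> R[i],
    (forall n, normal_functional M (phi_ n)) /\
    forall phi (eps : R[i]), normal_functional M phi -> 0 < eps ->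
      exists n, forall x, M x -> (forall u, `|x u| <= `|u|) ->
        `|phi x - phi_ n x| <= eps.

Record normal_faithful_trace M tau : Prop := {
  tau_linear : forall (a : R[i]) x y, M x -> M y ->
    tau (a \*: x \+ y) = a * tau x + tau y ;
  tau_tracial : forall x y, M x -> M y -> tau (x \o y) = tau (y \o x) ;
  tau_pos : forall x y, M x -> M y -> is_adjoint x y -> 0 <= tau (y \o x) ;
  tau_faithful : forall x y, M x -> M y -> is_adjoint x y ->
    tau (y \o x) = 0 -> x = (fun=> 0) ;
  tau_unit : tau idfun = 1 ;
  tau_normal : normal_functional M tau }.

Definition projection_partition M P : Prop :=
  [/\ forall p, p \in P -> M p /\ projection p,
      forall p q, p \in P -> q \in P -> p != q -> p \o q = (fun=> 0) &
      forall u, \sum_(p <- P) p u = u].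

(* [tau] is real-valued on projections, so that [Re] loses no information. *)
Definition indexI1 tau x P : R :=
  \sum_(p <- P) \sum_(q <- P | p \o x \o q != (fun=> 0))
    complex.Re (tau p) * complex.Re (tau q).

Definition indexI_at tau X P : R := \sum_(x <- X) indexI1 tau x P.

Definition indexI M tau X : \bar R :=
  ereal_inf [set (indexI_at tau X P)%:E | P in projection_partition M].

Definition generates M X : Prop :=
  [set` X] `<=` M /\ W_star [set` X] = M.

Definition generates_sa M X : Prop :=
  generates M X /\ forall x, x \in X -> is_adjoint x x.

Definition calG M tau : \bar R := ereal_inf [set indexI M tau X | X in generates M].

Definition calG_sa M tau : \bar R :=
  ereal_inf [set indexI M tau X | X in generates_sa M].

(* Infima of sets of natural numbers, hence minima unless [+oo]. *)
Definition calGmin M : \bar R :=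
  ereal_inf [set (#|` X|%:R : R)%:E | X in generates M].

Definition calGmin_sa M : \bar R :=
  ereal_inf [set (#|` X|%:R : R)%:E | X in generates_sa M].

(* [pMp], acting on [H] with unit [p]; [W_star] of a subset of [pMp] is the same
   computed in [B(H)] or in [B(pH)]. *)
Definition corner M p : set (H -> H) := [set p \o x \o p | x in M].

End VonNeumann.

(* Main.v *)
Require Import Defs.
From HB Require Import structures.
From mathcomp Require Import all_boot all_order all_algebra.
From mathcomp Require Import finmap complex sesquilinear.
From mathcomp Require Import all_classical all_reals all_analysis.

Set Implicit Arguments.
Unset Strict Implicit.
Unset Printing Implicit Defensive.

Import Order.TTheory GRing.Theory Num.Theory.
Import numFieldNormedType.Exports.
Local Open Scope classical_set_scope.
Local Open Scope ring_scope.
Local Open Scope complex_scope.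

(* Write x' for the adjoint of x, and let tau(p) = 1/k.  By comparison of
   projections there are partial isometries v_1, ..., v_k with v_i' v_i = p whose
   range projections v_i v_i' sum to 1.

   If n elements y generate pMp, then the elements v_1 y v_1' together with
   v_i v_1' + v_1 v_i', i > 1, generate M and, relative to the partition formed
   by the v_i v_i', have total index at most (n + 2k) / k^2.

   Conversely, given a finite X generating M and a partition P, the v_i can be
   chosen so that all but at most #|P| of the ranges lie under elements of P.
   The nonzero compressions v_i' x v_j, of which there are at most
   k^2 I(X; P) + 2 k #|P| #|X|, generate pMp; when X is self-adjoint each pair of
   adjoint compressions is replaced by its real and imaginary parts.

   Comparison is obtained without the bicommutant theorem or a functional
   calculus: the Newton-Schulz iteration x |-> x + (x - x x' x) / 2 converges
   strongly to the partial isometry of the polar decomposition, and maximal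
   partial isometries are found by exhausting the trace. *)

(** * The algebra of adjointable operators *)

(** In the matrix picture [M] is the algebra of k by k matrices over pMp, the entries of x being
    v_i' x v_j. Each cell of the grid weighs 1/k^2, so an index counts nonzero entries. The two
    constructions give G(M) <= Gmin(pMp)/k^2 + 2/k and Gmin(pMp)/k^2 <= I(X; P) + 2 #|P| #|X| / k
    for every k >= 1. As X and P are fixed before k grows, these bounds alone yield both existence
    and value of the limit. The traces of the elements of P need not be multiples of 1/k: each
    element leaves a remainder of trace below 1/k, and the v_i filling the remainders spoil at most
    #|P| rows and columns. [W_star] is an intersection, so its elements have no explicit form.
    Generation is proved by exhibiting von Neumann algebras: the operators whose compressions all
    lie in a given N form one, because v_i' f g v_j is the sum over l of (v_i' f v_l)(v_l' g v_j),
    which is matrix multiplication. The linking elements are symmetrized so that one construction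
    serves both limits. *)

Section Operators.
Context {R : realType} {H : completeNormedModType R[i]}.
Context (ip : {dot H for (@Num.conj R[i])}).

Lemma ipC u v : ip u v = (ip v u)^*%C.
Proof. by rewrite (hermC ip) mul1r. Qed.

Lemma ip_ext u v : (forall w, ip w u = ip w v) -> u = v.
Proof.
move=> h; apply/eqP; rewrite -subr_eq0 -(dnorm_eq0 ip); apply/eqP.
by rewrite linearBr/= h subrr.
Qed.

Lemma ip_extl u v : (forall w, ip u w = ip v w) -> u = v.
Proof. by move=> h; apply: ip_ext => w; rewrite ipC h -ipC. Qed.

Lemma is_adjoint_sym (x y : H -> H) : is_adjoint ip x y -> is_adjoint ip y x.
Proof. by move=> xy u v; rewrite ipC -xy -ipC. Qed.

Lemma is_adjoint_uniq (x y z : H -> H) :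
  is_adjoint ip x y -> is_adjoint ip x z -> y = z.
Proof. by move=> xy xz; apply/funext => v; apply: ip_ext => w; rewrite -xy xz. Qed.

(** The adjoint is part of the predicate, so no Riesz representation is involved; members of a von
    Neumann algebra qualify through [vN_adj]. *)
Definition adjointable : {pred H -> H} := fun x =>
  `[< bounded_op x /\ exists2 y, bounded_op y & is_adjoint ip x y >].

Lemma adjointableP x : reflect
  (bounded_op x /\ exists2 y, bounded_op y & is_adjoint ip x y)
  (x \in adjointable).
Proof. exact: asboolP. Qed.

Lemma bounded_op0 : bounded_op (0 : H -> H).
Proof.
by split=> [a u v|]; [rewrite /= scaler0 addr0|move=> u; exact: cvg_cst].
Qed.

Lemma bounded_opP (a : R[i]) (x y : H -> H) :
  bounded_op x -> bounded_op y -> bounded_op (a *: x + y).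
Proof.
move=> [lx cx] [ly cy]; split.
  move=> b u v; rewrite !fctE lx ly !scalerDr !scalerA [b * a]mulrC !addrA.
  by congr (_ + _); rewrite -!addrA; congr (_ + _); rewrite addrC.
move=> u; apply: cvgD; last exact: cy.
by apply: cvgZl_tmp; exact: cx.
Qed.

Lemma adjointable_submod : submod_closed adjointable.
Proof.
split.
  apply/adjointableP; split; first exact: bounded_op0.
  exists 0; first exact: bounded_op0.
  by move=> u v; rewrite linear0l linear0r.
move=> a x y /adjointableP[bx [x' bx' xx']] /adjointableP[by_ [y' by' yy']].
apply/adjointableP; split; first exact: bounded_opP.
exists (a^*%C *: x' + y'); first exact: bounded_opP.
move=> u v; rewrite !fctE linearDl/= linearDr/= linearZl_LR linearZr_LR/=.
by rewrite conjCK xx' yy'.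
Qed.

HB.instance Definition _ := GRing.isSubmodClosed.Build _ _ adjointable
  adjointable_submod.

(** Bundled so that composition becomes a ring product, and identities between projections and
    partial isometries become ring rewriting. *)
Record bop := Bop { bval :> H -> H; bvalP : bval \in adjointable }.

HB.instance Definition _ := [isSub for bval].
HB.instance Definition _ := [Choice of bop by <:].
HB.instance Definition _ := [SubChoice_isSubLmodule of bop by <:].

Lemma bop_ext (x y : bop) : x =1 y :> (H -> H) -> x = y.
Proof. by move=> h; apply: val_inj; exact/funext. Qed.

Lemma adjointable_id : (idfun : H -> H) \in adjointable.
Proof.
have b : bounded_op (idfun : H -> H) by split=> // u; exact: cvg_id.
by apply/adjointableP; split=> //; exists idfun.
Qed.

Lemma bounded_op_comp (x y : H -> H) :
  bounded_op x -> bounded_op y -> bounded_op (x \o y).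
Proof.
move=> [lx cx] [ly cy]; split; first by move=> a u v /=; rewrite ly lx.
by move=> u; apply: continuous_comp; [exact: cy|exact: cx].
Qed.

Lemma adjointable_comp (x y : bop) : (x : H -> H) \o y \in adjointable.
Proof.
have /adjointableP[bx [x' bx' xx']] := bvalP x.
have /adjointableP[yb [y' yb' yy']] := bvalP y.
apply/adjointableP; split; first exact: bounded_op_comp.
exists (y' \o x'); first exact: bounded_op_comp.
by move=> u v /=; rewrite xx' yy'.
Qed.

Definition bone := Bop adjointable_id.
Definition bmul (x y : bop) := Bop (adjointable_comp x y).

Lemma bop_bounded (x : bop) : bounded_op x.
Proof. by case/adjointableP: (bvalP x). Qed.

Lemma bop_linear (x : bop) : linear x.
Proof. by case: (bop_bounded x). Qed.

Lemma bop_continuous (x : bop) : continuous x.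
Proof. by case: (bop_bounded x). Qed.

HB.instance Definition _ (x : bop) :=
  GRing.isLinear.Build _ _ _ _ (x : H -> H) (bop_linear x).

Lemma bmulA : associative bmul. Proof. by move=> x y z; exact: bop_ext. Qed.
Lemma bmul1 : left_id bone bmul. Proof. by move=> x; exact: bop_ext. Qed.
Lemma bmulr1 : right_id bone bmul. Proof. by move=> x; exact: bop_ext. Qed.
Lemma bmulDl : left_distributive bmul +%R.
Proof. by move=> x y z; exact: bop_ext. Qed.
Lemma bmulDr : right_distributive bmul +%R.
Proof. by move=> x y z; apply: bop_ext => u /=; rewrite raddfD. Qed.

HB.instance Definition _ := GRing.Zmodule_isPzRing.Build bop
  bmulA bmul1 bmulr1 bmulDl bmulDr.

Lemma bmulE (x y : bop) u : (x * y) u = x (y u). Proof. by []. Qed.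
Lemma bopDE (x y : bop) u : (x + y) u = x u + y u. Proof. by []. Qed.
Lemma bopBE (x y : bop) u : (x - y) u = x u - y u. Proof. by []. Qed.
Lemma bopZE a (x : bop) u : (a *: x) u = a *: x u. Proof. by []. Qed.
Lemma bop1E u : (1 : bop) u = u. Proof. by []. Qed.
Lemma bop0E u : (0 : bop) u = 0. Proof. by []. Qed.

Lemma bscaleAl a (x y : bop) : a *: (x * y) = (a *: x) * y.
Proof. exact: bop_ext. Qed.

Lemma bscaleAr a (x y : bop) : a *: (x * y) = x * (a *: y).
Proof. by apply: bop_ext => u; rewrite bopZE !bmulE bopZE linearZ. Qed.

Lemma has_adj (x : bop) : exists y : bop, is_adjoint ip x y.
Proof.
have /adjointableP[bx [y yb xy]] := bvalP x; have yA : y \in adjointable.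
  by apply/adjointableP; split=> //; exists x => //; exact: is_adjoint_sym.
by exists (Bop yA).
Qed.

Definition adjo (x : bop) : bop := projT1 (cid (has_adj x)).

Lemma adjoP (x : bop) : is_adjoint ip x (adjo x).
Proof. by rewrite /adjo; case: cid. Qed.

Lemma adjoE (x : bop) u v : ip (x u) v = ip u (adjo x v).
Proof. exact: adjoP. Qed.

Lemma adjoEr (x : bop) u v : ip u (x v) = ip (adjo x u) v.
Proof. by rewrite ipC adjoP -ipC. Qed.

Lemma adjo_uniq (x y : bop) : is_adjoint ip x y -> adjo x = y.
Proof. by move=> xy; apply: val_inj; apply: is_adjoint_uniq (adjoP x) xy. Qed.

Lemma adjoK : involutive adjo.
Proof. by move=> x; apply: adjo_uniq => u v; rewrite -adjoEr. Qed.

Lemma adjoM (x y : bop) : adjo (x * y) = adjo y * adjo x.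
Proof. by apply: adjo_uniq => u v; rewrite !bmulE !adjoE. Qed.

Lemma adjoD (x y : bop) : adjo (x + y) = adjo x + adjo y.
Proof.
by apply: adjo_uniq => u v; rewrite !bopDE linearDl/= linearDr/= !adjoE.
Qed.

Lemma adjoZ a (x : bop) : adjo (a *: x) = a^*%C *: adjo x.
Proof.
apply: adjo_uniq => u v; rewrite !bopZE linearZl_LR linearZr_LR/= adjoE.
by rewrite conjCK.
Qed.

Lemma adjoN (x : bop) : adjo (- x) = - adjo x.
Proof. by apply: adjo_uniq => u v; rewrite linearNl linearNr/= adjoE. Qed.

Lemma adjoB (x y : bop) : adjo (x - y) = adjo x - adjo y.
Proof. by rewrite adjoD adjoN. Qed.

Lemma adjo0 : adjo 0 = 0. Proof. by rewrite -{1}(subrr 0) adjoB subrr. Qed.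

Lemma adjo1 : adjo 1 = 1. Proof. exact: adjo_uniq. Qed.

End Operators.

(** * Strong limits of contractions *)

Section StrongLimits.
Context {R : realType} {H : completeNormedModType R[i]}.
Context (ip : {dot H for (@Num.conj R[i])}).
Hypothesis ip_norm : forall u : H, ip u u = `|u| ^+ 2.
Local Notation bop := (bop ip).
Implicit Types (x y z v w : bop) (u : H).

Lemma cauchy_schwarz (u v : H) : `|ip u v| <= `|u| * `|v|.
Proof.
rewrite -(@ler_pXn2r _ 2)// ?nnegrE ?mulr_ge0//.
have [->|v0] := eqVneq v 0; first by rewrite linear0r normr0 normr0 mulr0 !expr0n.
rewrite exprMn -!ip_norm.
have ipv : ip v v != 0 by rewrite (dnorm_eq0 ip).
have ipv0 : 0 < ip v v by rewrite (dnorm_gt0 ip).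
pose a := ip u v / ip v v; pose r := u - a *: v.
have rv : ip r v = 0 by rewrite linearBl/= linearZl_LR/= divfK// subrr.
have -> : u = r + a *: v by rewrite subrK.
rewrite linearDl/= rv add0r linearZl_LR/= normrM (ger0_norm (dnorm_ge0 ip _)).
rewrite hnormDd; last by rewrite linearZr_LR/= rv mulr0.
rewrite linearZl_LR linearZr_LR/= exprMn normCK mulrDl -!mulrA lerDr.
by rewrite mulr_ge0// dnorm_ge0.
Qed.

Lemma cvg_ipl (f : nat -> H) (a b : H) :
  f @ \oo --> a -> (forall e : R[i], 0 < e ->
    \forall n \near \oo, `|ip (a - f n) b| < e).
Proof.
move=> fa e e0.
have b1 : 0 < `|b| + 1 by rewrite ltr_wpDl.
move/cvgrPdist_lt: fa => /(_ (e / (`|b| + 1))).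
rewrite divr_gt0// => /(_ isT); apply: filterS => n h.
apply: le_lt_trans (cauchy_schwarz _ _) _.
rewrite -[ltRHS](@divfK _ (`|b| + 1)) ?gt_eqF//.
apply: (@le_lt_trans _ _ (`|a - f n| * (`|b| + 1))).
  by rewrite ler_wpM2l// lerDl.
by rewrite ltr_pM2r.
Qed.

(* Pairings of norm convergent sequences are compared with those of the limit
   through this statement, which avoids the topology of R[i]. *)
Lemma ip_limit (f g : nat -> H) (a a' b b' : H) :
  f @ \oo --> a -> g @ \oo --> a' ->
  (forall n, ip (f n) b = ip b' (g n)) -> ip a b = ip b' a'.
Proof.
move=> fa ga h; apply/eqP; rewrite -subr_eq0 -normr_le0.
apply/ler_addgt0Pr => e e0; rewrite add0r.
have e2 : 0 < e / 2 by rewrite divr_gt0.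
near \oo => n.
have -> : ip a b - ip b' a' = ip (a - f n) b - (ip (a' - g n) b')^*%C.
  rewrite -ipC linearBl/= linearBr/= -h opprB addrA.
  by rewrite subrK.
apply: (le_trans (ler_normB _ _)); rewrite norm_conjC [leRHS]splitr.
apply: lerD; apply: ltW; near: n; exact: cvg_ipl.
Unshelve. all: by end_near. Qed.

Definition contractive x := forall u, `|x u| <= `|u|.

(** Write x' for the adjoint: |x' u|^2 = <u, x x' u> <= |u| |x' u|, then divide by |x' u|. *)
Lemma adj_contractive x : contractive x -> contractive (adjo x).
Proof.
move=> xc u; have [->|x0] := eqVneq (adjo x u) 0; first by rewrite normr0.
have n0 : 0 < `|adjo x u| by rewrite normr_gt0.
rewrite -(ler_pM2l n0) -expr2 -ip_norm -adjoEr.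
rewrite -[leLHS]ger0_norm; last by rewrite adjoEr dnorm_ge0.
rewrite mulrC; apply: (le_trans (cauchy_schwarz _ _)).
by rewrite ler_wpM2l// xc.
Qed.

(** Strong convergence of the adjoints is included so that limits commute with [adjo]; the uniform
    bound makes products converge, see [sot_app]. *)
Record sot_cvg (x : nat -> bop) v : Prop := SotCvg {
  sot_contr : forall n, contractive (x n) ;
  sot_lim : forall u, (fun n => x n u) @ \oo --> v u ;
  sot_limA : forall u, (fun n => adjo (x n) u) @ \oo --> adjo v u }.

Lemma lim_eq (f g : nat -> H) (a b : H) : f =1 g ->
  f @ \oo --> a -> g @ \oo --> b -> a = b.
Proof.
move=> /funext -> ga gb.
by apply: cvg_unique ga gb; exact: norm_hausdorff.
Qed.

Lemma sot_adj (x : nat -> bop) v : sot_cvg x v -> sot_cvg (fun n => adjo (x n)) (adjo v).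
Proof.
move=> [xc xl xA]; split => // n; first exact: adj_contractive.
by rewrite adjoK; under eq_fun do rewrite adjoK; exact: xl.
Qed.

Lemma sot_app (x : nat -> bop) v (f : nat -> H) a : sot_cvg x v ->
  f @ \oo --> a -> (fun n => x n (f n)) @ \oo --> v a.
Proof.
move=> [xc xl _] fa.
have -> : (fun n => x n (f n)) = (fun n => x n (f n - a) + x n a).
  by apply/funext => n; rewrite raddfB subrK.
rewrite -[v a]add0r; apply: cvgD; last exact: xl.
apply/cvgr0Pnorm_lt => e e0.
move/cvgrPdist_lt: fa => /(_ e e0); apply: filterS => n.
by apply: le_lt_trans; rewrite distrC; exact: xc.
Qed.

(** The hypothesis gives |x_m u - x_n u|^2 + |x_n u|^2 <= |x_m u|^2. The squared norms thus
    increase, are bounded by |u|^2, and control the distances, so the sequence is Cauchy. Newton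
    iterates and chains of extensions of partial isometries both satisfy it. *)
Lemma monotone_cvg (x : nat -> bop) :
  (forall n, contractive (x n)) ->
  (forall n m u, (n <= m)%N -> 0 <= ip (x m u - x n u) (x n u)) ->
  forall u, cvgn (fun n => x n u).
Proof.
move=> xc xm u.
have sq n m : (n <= m)%N ->
    `|x m u - x n u| ^+ 2 + `|x n u| ^+ 2 <= `|x m u| ^+ 2.
  move=> nm; set d := x m u - x n u; have -> : x m u = d + x n u by rewrite subrK.
  have d0 : 0 <= ip d (x n u) by exact: xm.
  clearbody d.
  by rewrite -!ip_norm (hnormD ip)/= mul1r lerDl addr_ge0 ?conjC_ge0.
(* The squared norms are moved from [R[i]] to [R], where bounded monotone sequences converge. *)
pose f n : R := complex.Re (`|x n u| ^+ 2).
have fE n : (f n)%:C = `|x n u| ^+ 2 by rewrite /f RRe_real// realX// ger0_real.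
have f_mono : {homo f : n m / (n <= m)%N >-> n <= m}.
  move=> n m nm; rewrite -lecR !fE; apply: le_trans (sq _ _ nm).
  by rewrite lerDr exprn_ge0.
have f_bd : has_ubound (range f).
  exists (complex.Re (`|u| ^+ 2)) => _ [n _ <-].
  rewrite -lecR fE RRe_real ?realX ?ger0_real//.
  by rewrite lerXn2r ?nnegrE// xc.
apply/cauchy_cvgP/cauchy_exP => e e0.
have eR : e = (complex.Re e)%:C by rewrite RRe_real// gtr0_real.
have e2 : 0 < complex.Re e ^+ 2 by rewrite exprn_gt0// -ltcR -eR.
have [n] : exists n, forall m, (n <= m)%N -> f m - f n < complex.Re e ^+ 2.
  have /cvgrPdist_lt/(_ _ e2) [n _ /(_ n (leqnn n)) h] := nondecreasing_cvgn f_mono f_bd.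
  exists n => m nm; apply: le_lt_trans h; apply: le_trans (ler_norm _).
  by rewrite lerB// ub_le_sup//; exists m.
move=> h; exists (x n u); exists n => // m /= nm.
rewrite -ball_normE/= -(@ltr_pXn2r _ 2)// ?nnegrE// ?ltW//.
rewrite distrC; apply: (@le_lt_trans _ _ (`|x m u| ^+ 2 - `|x n u| ^+ 2)).
  by rewrite lerBrDr sq.
by rewrite -!fE -rmorphB/= [in ltRHS]eR -rmorphXn/= ltcR h.
Qed.

(** The two pointwise limits are bounded operators, and [ip_limit] makes them adjoint to each other;
    this is what puts the limit in [bop]. *)
Lemma sot_exists (x : nat -> bop) :
  (forall n, contractive (x n)) ->
  (forall u, cvgn (fun n => x n u)) -> (forall u, cvgn (fun n => adjo (x n) u)) ->
  exists v, sot_cvg x v.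
Proof.
have contr_lim (f : nat -> bop) (g : H -> H) : (forall n, contractive (f n)) ->
    (forall u, (fun n => f n u) @ \oo --> g u) -> bounded_op g.
  move=> fc fg.
  have gl : linear g.
    move=> a u v; have h : (fun n => a *: f n u + f n v) @ \oo --> a *: g u + g v.
      by apply: cvgD; [apply: cvgZl_tmp|]; exact: fg.
    have E : (fun n => f n (a *: u + v)) =1 (fun n => a *: f n u + f n v).
      by move=> n; rewrite linearP.
    exact: lim_eq E (fg _) h.
  have gc u : `|g u| <= `|u|.
    apply/ler_addgt0Pr => e e0.
    have /cvgrPdist_lt/(_ e e0) [n _ /(_ n (leqnn n)) h] := fg u.
    rewrite -[in leLHS](subrK (f n u) (g u)) addrC.
    apply: le_trans (ler_normD _ _) _; apply: lerD; first exact: fc.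
    exact: ltW.
  split=> // u; apply/cvgrPdist_lt => e e0.
  have /cvgrPdist_lt/(_ e e0) := @cvg_id _ (nbhs u).
  apply: filterS => w; apply: le_lt_trans.
  suff -> : g u - g w = g (u - w) by exact: gc.
  by have := gl (-1) w u; rewrite !scaleN1r addrC => <-; rewrite addrC.
move=> xc xl xA.
pose g u := lim ((fun n => x n u) @ \oo).
pose g' u := lim ((fun n => adjo (x n) u) @ \oo).
have gb : bounded_op g by apply: contr_lim xc _ => u; exact: xl.
have gb' : bounded_op g'.
  by apply: (contr_lim (fun n => adjo (x n)));
    [move=> n; exact: adj_contractive|move=> u; exact: xA].
have gg' : is_adjoint ip g g'.
  by move=> u w; apply: (ip_limit (xl _) (xA _)) => n; rewrite adjoE.
have gA : g \in adjointable ip by apply/adjointableP; split=> //; exists g'.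
exists (Bop gA); split=> // u.
suff -> : adjo (Bop gA) u = g' u by exact: xA.
by rewrite (is_adjoint_uniq (adjoP (Bop gA)) gg').
Qed.

End StrongLimits.

(** * Polar parts by the Newton-Schulz iteration *)

Section PolarPart.
Context {R : realType} {H : completeNormedModType R[i]}.
Context (ip : {dot H for (@Num.conj R[i])}).
Hypothesis ip_norm : forall u : H, ip u u = `|u| ^+ 2.
Local Notation bop := (bop ip).
Implicit Types (x y z v w : bop) (u : H) (K : set bop).

Definition positive x := forall u, 0 <= ip (x u) u.

Lemma positiveD x y : positive x -> positive y -> positive (x + y).
Proof. by move=> px py u; rewrite bopDE linearDl/= addr_ge0. Qed.

Lemma positiveZ (a : R[i]) x : 0 <= a -> positive x -> positive (a *: x).
Proof. by move=> a0 px u; rewrite bopZE linearZl_LR/= mulr_ge0. Qed.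

Lemma positive_adj_mul x : positive (adjo x * x).
Proof. by move=> u; rewrite bmulE -adjoEr dnorm_ge0. Qed.

Lemma positive_conj x y : positive x -> positive (adjo y * x * y).
Proof. by move=> px u; rewrite !bmulE -adjoEr px. Qed.

Lemma contractiveP x : positive (1 - adjo x * x) -> contractive x.
Proof.
move=> h u; have := h u.
rewrite bopBE bop1E bmulE linearBl/= -adjoEr !ip_norm subr_ge0.
by rewrite ler_pXn2r// nnegrE.
Qed.

Lemma contractive_positive x : contractive x -> positive (1 - adjo x * x).
Proof.
move=> h u; rewrite bopBE bop1E bmulE linearBl/= -adjoEr !ip_norm subr_ge0.
by rewrite ler_pXn2r// nnegrE.
Qed.

Section ContractionCalculus.
Variable x : bop.
Hypothesis x_contr : contractive x.
Let t := adjo x * x.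
Let b := 1 - t.

Let b_pos : positive b. Proof. exact: contractive_positive. Qed.
Let t_pos : positive t. Proof. exact: positive_adj_mul. Qed.
Let adjt : adjo t = t. Proof. by rewrite /t adjoM adjoK. Qed.
Let adjb : adjo b = b. Proof. by rewrite /b adjoB adjo1 adjt. Qed.
Let tb : GRing.comm t b.
Proof. by rewrite /b; apply: commrB; [exact: commr1|exact: commr_refl]. Qed.

Let adj_exp n : adjo (b ^+ n) = b ^+ n.
Proof.
elim: n => [|n ih]; first by rewrite expr0 adjo1.
by rewrite exprS adjoM ih adjb -exprSr exprS.
Qed.

(** Positivity of a product of commuting positive operators normally takes a square root. Here t + b
    = 1 gives b t = (t + b) b t = t b t + b t b, a sum of conjugates of positive operators. *)
Let bt_pos : positive (b * t).
Proof.
have -> : b * t = adjo t * b * t + adjo b * t * b.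
  have tb1 : t + b = 1 by rewrite addrC subrK.
  rewrite adjt adjb -{1}[b * t]mul1r -tb1 mulrDl; congr (_ + _).
    by rewrite (mulrA t b t).
  by rewrite -{1}tb (mulrA b t b).
by apply: positiveD; exact: positive_conj.
Qed.

(* Powers of [b] and their products with [t] are positive; iterating the closure
   property defining [tame] yields positivity of polynomials in [b] with
   nonnegative coefficients. *)
Definition tested y := forall n, positive (y * b ^+ n) /\ positive (y * b ^+ n * t).

Definition tame z := [/\ adjo z = z, (forall y, GRing.comm y b -> GRing.comm y z)
  & forall y, tested y -> tested (y * z)].

(** Moving half of the factors [b] to each side exhibits the operator as a conjugate, by a power of
    [b], of one of 1, [b], [t] and [b * t]. *)
Lemma tested1 : tested 1.
Proof.
move=> n; rewrite mul1r -(odd_double_half n).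
set k := n./2; have bk : b ^+ (odd n + k.*2) = adjo (b ^+ k) * b ^+ odd n * b ^+ k.
  by rewrite adj_exp -!exprD addnC -addnn -!addnA; congr (_ ^+ (_ + _)); rewrite addnC.
have tbk : GRing.comm t (b ^+ k) by apply: commrX.
split.
  rewrite bk; apply: positive_conj; case: (odd n); first by rewrite expr1.
  by move=> u; rewrite expr0 bop1E dnorm_ge0.
rewrite bk -(mulrA _ (b ^+ k) t) -tbk (mulrA _ t) -(mulrA _ _ t).
apply: positive_conj; case: (odd n); first by rewrite expr1.
by rewrite expr0 mul1r.
Qed.

Lemma tame1 : tame 1.
Proof. by split=> [|y _|y]; [exact: adjo1|exact: commr1|rewrite mulr1]. Qed.

Lemma tameb : tame b.
Proof.
split=> // y yt n; have := yt n.+1.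
by rewrite exprS !mulrA.
Qed.

Lemma tameD y z : tame y -> tame z -> tame (y + z).
Proof.
move=> [ay cy ty] [az cz tz]; split=> [|w wb|w wt n].
- by rewrite adjoD ay az.
- by apply: commrD; [exact: cy|exact: cz].
have [h1 h2] := ty _ wt n; have [h3 h4] := tz _ wt n.
by rewrite mulrDr !mulrDl; split; exact: positiveD.
Qed.

Lemma tameM y z : tame y -> tame z -> tame (y * z).
Proof.
move=> [ay cy ty] [az cz tz]; split=> [|w wb|w wt].
- by rewrite adjoM ay az; apply/esym/cz/commr_sym/cy/commr_refl.
- by apply: commrM; [exact: cy|exact: cz].
by rewrite mulrA; apply/tz/ty.
Qed.

Lemma tameZ (a : R) z : 0 <= a -> tame z -> tame (a%:C *: z).
Proof.
move=> a0 [az cz tz]; split=> [|w wb|w wt n].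
- by rewrite adjoZ az; congr (_ *: _); rewrite conjc_real.
- by rewrite /GRing.comm -bscaleAr -bscaleAl (cz w wb).
have [h1 h2] := tz _ wt n.
by rewrite -bscaleAr -!bscaleAl; split; apply: positiveZ => //; rewrite lecR.
Qed.

Lemma tame_pos z : tame z -> positive z /\ positive (t * z).
Proof.
move=> [_ cz tz]; have := tz _ tested1 0; rewrite expr0 mul1r mulr1.
by have -> : t * z = z * t by exact: cz.
Qed.

End ContractionCalculus.

(* The Newton-Schulz step: it acts on singular values as s |-> s (3 - s^2) / 2,
   which increases to 1 on ]0, 1]. *)
Definition newton x := x + (2^-1)%:C *: (x - x * adjo x * x).

Lemma newtonE x : newton x = x * (1 + (2^-1)%:C *: (1 - adjo x * x)).
Proof. by rewrite /newton mulrDr mulr1 -bscaleAr mulrBr mulr1 mulrA. Qed.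

Lemma adj_newton x : adjo (newton x) = newton (adjo x).
Proof.
rewrite /newton adjoD adjoZ adjoB !adjoM adjoK mulrA; congr (_ + _ *: _).
by rewrite conjc_real.
Qed.

Lemma adj_iter_newton n x : adjo (iter n newton x) = iter n newton (adjo x).
Proof. by elim: n => //= n <-; rewrite adj_newton. Qed.

Section NewtonIteration.
Variable x : bop.
Hypothesis x_contr : contractive x.
Let X n := iter n newton x.

(** Here c is half the defect 1 - X_n' X_n. Everything the iteration produces is x times a
    polynomial in [b] with nonnegative coefficients, which is why [tame] is preserved. *)
Lemma newton_tame n : exists g c, [/\ tame x g, tame x c, X n = x * g,
  X n.+1 = X n * (1 + c) & adjo (X n) * X n = 1 - c - c].
Proof.
have half y : y = (2^-1)%:C *: y + (2^-1)%:C *: y.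
  rewrite -scalerDl -rmorphD/= -{1}[y]scale1r; congr (_ *: _).
  by rewrite -[LHS]/(1%:C); congr (_%:C); rewrite [LHS]splitr mul1r.
pose c0 y : bop := (2^-1)%:C *: (1 - adjo y * y).
have sub2 y : adjo y * y = 1 - c0 y - c0 y.
  by rewrite -addrA -opprD -half opprB addrC subrK.
elim: n => [|n [g [c [tg tc Xg Xc tn]]]].
  exists 1, (c0 x); split; rewrite ?mulr1//; first exact: tame1.
  - by apply: tameZ; [rewrite invr_ge0|exact: tameb].
  - by rewrite /X/= newtonE.
have t1c : tame x (1 + c) by apply: tameD => //; exact: tame1.
exists (g * (1 + c)), (c0 (X n.+1)); split.
- exact: tameM.
- apply: tameZ; first by rewrite invr_ge0.
  (* The new defect is 1 - (1 + c)(1 - 2c)(1 + c) = 3 c^2 + 2 c^3: no negative coefficient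
     appears. *)
  have -> : 1 - adjo (X n.+1) * X n.+1 =
      c * c + (c * c + c * c + (c * c * c + c * c * c)).
    have [a1c _ _] := t1c.
    rewrite Xc adjoM a1c mulrA -(mulrA _ (adjo (X n))) tn.
    have h1 : (1 + c) * (1 - c) = 1 - c * c.
      by rewrite mulrDl mul1r mulrBr mulr1 addrA subrK.
    have h2 : (1 - c) * (1 + c) = 1 - c * c.
      by rewrite mulrBl mul1r mulrDr mulr1 opprD addrA addrK.
    rewrite mulrBr h1 [(1 + c) * c]mulrDl mul1r opprD addrACA -opprD.
    by rewrite mulrBl h2 mulrDr mulr1 mulrDl -addrA -opprD opprB addrC subrK.
  have tcc := tameM tc tc.
  have tccc := tameM tcc tc.
  by do ![apply: tameD => //].
- by rewrite Xc Xg mulrA.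
- by rewrite {1}/X iterS newtonE.
- exact: sub2.
Qed.

Lemma newton_chain n k : exists2 h, tame x h & X (n + k) = X n + X n * h.
Proof.
elim: k => [|k [h th Xh]].
  exists 0; last by rewrite addn0 mulr0 addr0.
  split; first exact: adjo0.
  - by move=> y _; exact: commr0.
  - move=> y _ m; rewrite mulr0 !mul0r.
    by split=> u; rewrite bop0E linear0l.
have [g [c [tg tc _ Xc _]]] := newton_tame (n + k).
exists (h + c + h * c); first by apply: tameD; [exact: tameD|exact: tameM].
rewrite addnS Xc Xh mulrDr mulr1 !mulrDl !mulrDr mulrA.
by rewrite -!addrA; congr (_ + _); rewrite !addrA.
Qed.

Lemma newton_contractive n : contractive (X n).
Proof.
apply: contractiveP; have [g [c [_ tc _ _ ->]]] := newton_tame n.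
have -> : 1 - (1 - c - c) = c + c by rewrite -addrA -opprD opprB addrC subrK.
by have [pc _] := tame_pos x_contr tc; exact: positiveD.
Qed.

(** With X_m = X_n (1 + h) and X_n = x g, the pairing is that of t g g h at u, and g g h is
    [tame]. *)
Lemma newton_monotone n m u : (n <= m)%N ->
  0 <= ip (X m u - X n u) (X n u).
Proof.
move=> /subnKC <-; have [h th ->] := newton_chain n (m - n).
have [g [c [tg tc Xg _ _]]] := newton_tame n.
rewrite bopDE addrC addKr adjoEr -bmulE.
have [ag _ _] := tg.
have -> : adjo (X n) * (X n * h) = adjo x * x * (g * (g * h)).
  rewrite Xg adjoM ag -!mulrA; have tgh := tameM tg (tameM tg th).
  rewrite (mulrA (adjo x)) (mulrA (adjo x)).
  have [_ cg _] := tg; rewrite !mulrA -(mulrA _ (adjo x)) -(cg (adjo x * x)) ?mulrA//.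
  rewrite /GRing.comm mulrBr mulrBl mulr1 mul1r.
  by [].
by have [_] := tame_pos x_contr (tameM tg (tameM tg th)); apply.
Qed.

End NewtonIteration.

(** The adjoints of the iterates are the iterates of the adjoint, so monotonicity yields convergence
    on both sides. A fixed point of [newton] satisfies v v' v = v. *)
Lemma newton_limit x : contractive x ->
  exists2 v, sot_cvg (fun n => iter n newton x) v &
    v * adjo v * v = v /\ (x <> 0 -> v <> 0).
Proof.
move=> xc; have xa := adj_contractive ip_norm xc.
have nc := newton_contractive xc.
have nca := newton_contractive xa.
have cv := monotone_cvg ip_norm nc (newton_monotone xc).
have cva := monotone_cvg ip_norm nca (newton_monotone xa).
have [||v vl] := sot_exists ip_norm nc => //.
  by move=> u; under eq_fun do rewrite adj_iter_newton; exact: cva.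
exists v => //; split.
  have [_ l lA] := vl.
  have fix_v : newton v = v.
    apply: bop_ext => u.
    have h : (fun n => iter n.+1 newton x u) @ \oo --> newton v u.
      have h3 := sot_app vl (sot_app (sot_adj ip_norm vl) (l u)).
      apply: cvgD; first exact: l.
      by apply: cvgZl_tmp; apply: cvgB; [exact: l|exact: h3].
    apply: lim_eq h _ => //.
    by rewrite (cvg_shiftS (fun n => iter n newton x u)); exact: l.
  move: fix_v => /(canRL (addKr _)); rewrite addNr => /eqP.
  rewrite scaler_eq0 => /orP[|].
    by rewrite fmorph_eq0 invr_eq0 pnatr_eq0.
  by rewrite subr_eq0 => /eqP.
move=> x0 v0; apply: x0; apply: bop_ext => u.
apply/eqP; rewrite bop0E -normr_le0.
apply/ler_addgt0Pr => e e0; rewrite add0r.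
have [_ /(_ u) + _] := vl.
move=> /cvgrPdist_lt/(_ e e0)[n _ /(_ n (leqnn n))].
rewrite v0 bop0E sub0r normrN => /ltW; apply: le_trans.
(* Comparison with the initial iterate gives |x u|^2 <= <X_n u, x u> <= |X_n u| |x u|, so a zero
   limit forces x u = 0. *)
have := @newton_monotone _ xc 0 n u (leq0n n).
rewrite linearBl/= subr_ge0 ip_norm => h.
have [->|xu] := eqVneq (x u) 0; first by rewrite normr0.
rewrite -(@ler_pM2r _ `|x u|) ?normr_gt0// -expr2.
apply: le_trans (cauchy_schwarz ip_norm _ _).
by apply: (le_trans h); rewrite real_ler_norm// ger0_real// (le_trans _ h)// exprn_ge0.
Qed.

Definition sot_closed K := forall (x : nat -> bop) v,
  (forall n, K (x n)) -> sot_cvg x v -> K v.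

Lemma bop_bound x : exists2 C : R, 0 < C & forall u, `|x u| <= C%:C * `|u|.
Proof.
have /linear_boundedP/pinfty_ex_gt0[r r0 h] :
    bounded_near (x : {linear H -> H}) (nbhs 0).
  by apply/linear_bounded_continuous; exact: bop_continuous.
have rE : r = (complex.Re r)%:C by rewrite RRe_real// gtr0_real.
by exists (complex.Re r); [rewrite -ltcR -rE|move=> u; rewrite -rE; exact: h].
Qed.

(** [K] is only asked to be stable under the triple product x x' x, not under products: this admits
    corners such as f M e with two different projections. *)
Lemma polar_part K : (forall (a : R[i]) x, K x -> K (a *: x)) ->
  (forall x y, K x -> K y -> K (x + y)) ->
  (forall x, K x -> K (x * adjo x * x)) -> sot_closed K ->
  forall x, K x -> x <> 0 -> exists v, [/\ K v, v <> 0 & v * adjo v * v = v].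
Proof.
move=> KZ KD KT Kc x Kx x0; have [C C0 xC] := bop_bound x.
(* The iteration starts from a contraction, so x is divided by a bound of its norm. *)
pose y := (C^-1)%:C *: x.
have y0 : y <> 0.
  move=> /(congr1 (fun z => C%:C *: z)); rewrite scaler0 scalerA -rmorphM/=.
  by rewrite mulfV ?gt_eqF// scale1r.
have yc : contractive y.
  move=> u; rewrite bopZE normrZ -(ler_pM2l (_ : 0 < C%:C)) ?ltcR// mulrA.
  rewrite ger0_norm ?lecR ?invr_ge0 ?(ltW C0)//.
  by rewrite -rmorphM/= mulfV ?gt_eqF// mul1r; exact: xC.
have [v vl [vv vn]] := newton_limit yc.
exists v; split=> //; last exact: vn.
apply: Kc vl; elim=> [|n ih] /=; first exact: KZ.
rewrite /newton; apply: (KD) => //; apply: (KZ); apply: (KD) => //.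
by rewrite -scaleN1r; apply: (KZ); exact: KT.
Qed.

End PolarPart.

(** * Comparison of projections in a factor with a trace *)

Section Comparison.
Context {R : realType} {H : completeNormedModType R[i]}.
Context {ip : {dot H for (@Num.conj R[i])}}.
Hypothesis ip_norm : forall u : H, ip u u = `|u| ^+ 2.
Local Notation bop := (bop ip).
Implicit Types (x y z v w e f : bop) (S : set bop).

Definition is_proj e := e * e = e /\ adjo e = e.

Definition is_pisom v := v * adjo v * v = v.

Lemma is_projC e : is_proj e -> is_proj (1 - e).
Proof.
move=> [ee ea]; split; last by rewrite adjoB adjo1 ea.
by rewrite mulrBr mulr1 mulrBl mul1r ee subrr subr0.
Qed.

Lemma is_projB e f : is_proj e -> is_proj f -> e * f = f -> is_proj (e - f).
Proof.
move=> [ee ea] [ff fa] ef; split; last by rewrite adjoB ea fa.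
have fe : f * e = f by rewrite -{1}fa -{1}ea -adjoM ef fa.
by rewrite mulrBl !mulrBr ee ef fe ff subrr subr0.
Qed.

Lemma is_projD e f : is_proj e -> is_proj f -> e * f = 0 -> is_proj (e + f).
Proof.
move=> [ee ea] [ff fa] ef; split; last by rewrite adjoD ea fa.
have fe : f * e = 0 by rewrite -{1}fa -{1}ea -adjoM ef adjo0.
by rewrite mulrDl !mulrDr ee ef fe ff addr0 add0r.
Qed.

Lemma is_proj1 : is_proj 1. Proof. by split; [rewrite mulr1|rewrite adjo1]. Qed.

Lemma is_proj0 : is_proj 0. Proof. by split; [rewrite mulr0|rewrite adjo0]. Qed.

Lemma is_proj_positive e : is_proj e -> positive e.
Proof. by move=> [ee ea]; rewrite -ee -{1}ea; exact: positive_adj_mul. Qed.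

Lemma is_pisomA v : is_pisom v -> is_pisom (adjo v).
Proof. by move=> /(congr1 (@adjo _ _ _)); rewrite /is_pisom !adjoM adjoK mulrA. Qed.

Lemma pisom_source v : is_pisom v -> is_proj (adjo v * v).
Proof.
by move=> vv; split; [rewrite -mulrA (mulrA v) vv|rewrite adjoM adjoK].
Qed.

Lemma pisom_range v : is_pisom v -> is_proj (v * adjo v).
Proof. by move=> /is_pisomA/pisom_source; rewrite adjoK. Qed.

Lemma pisom_contractive v : is_pisom v -> contractive v.
Proof.
move=> /pisom_source/is_projC/is_proj_positive h.
exact: contractiveP ip_norm _ h.
Qed.

Lemma is_proj_pisom e : is_proj e -> is_pisom e.
Proof. by move=> [ee ea]; rewrite /is_pisom ea ee ee. Qed.

Lemma mul_adj_eq0 x : adjo x * x = 0 -> x = 0.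
Proof.
move=> h; apply: bop_ext => u; apply/eqP; rewrite bop0E -(dnorm_eq0 ip).
by rewrite adjoEr -bmulE h bop0E linear0l.
Qed.

Lemma sot_const (x : nat -> bop) v a b d : sot_cvg x v ->
  (forall n, a * x n * b = d) -> a * v * b = d.
Proof.
move=> [_ l _] h; apply: bop_ext => u; rewrite !bmulE.
have E : (fun n => a (x n (b u))) =1 (fun=> d u).
  by move=> n; rewrite -!bmulE h.
apply: lim_eq E _ (@cvg_cst _ _ _ _ _).
by apply: continuous_cvg; [exact: bop_continuous|exact: l].
Qed.

Lemma sot_pisom (x : nat -> bop) v : sot_cvg x v ->
  (forall n, is_pisom (x n)) -> is_pisom v.
Proof.
move=> xv h; apply: bop_ext => u; rewrite !bmulE.
have [_ l _] := xv.
have E : (fun n => x n (adjo (x n) (x n u))) =1 (fun n => x n u).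
  by move=> n; rewrite -!bmulE h.
exact: lim_eq E (sot_app xv (sot_app (sot_adj ip_norm xv) (l u))) (l u).
Qed.

Lemma sot_proj (x : nat -> bop) v : sot_cvg x v ->
  (forall n, is_proj (x n)) -> is_proj v.
Proof.
move=> xv h; have [_ l lA] := xv; split; apply: bop_ext => u.
  have E : (fun n => x n (x n u)) =1 (fun n => x n u).
    by move=> n; rewrite -bmulE (h n).1.
  exact: lim_eq E (sot_app xv (l u)) (l u).
have E : (fun n => adjo (x n) u) =1 (fun n => x n u) by move=> n; rewrite (h n).2.
exact: lim_eq E (lA u) (l u).
Qed.

Lemma sot_shift (x : nat -> bop) v k : sot_cvg x v ->
  sot_cvg (fun n => x (n + k)%N) v.
Proof.
move=> [c l lA]; split=> // u.
  by rewrite (cvg_shiftn k (fun n => x n u)).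
by rewrite (cvg_shiftn k (fun n => adjo (x n) u)).
Qed.

(** The usual order on partial isometries: w - v has its range orthogonal to that of v and its
    source orthogonal to that of v. *)
Definition extends v w := adjo (w - v) * v = 0 /\ (w - v) * adjo v = 0.

Lemma extends_refl v : extends v v.
Proof. by rewrite /extends subrr adjo0 !mul0r. Qed.

Lemma extends_source v w : is_pisom v -> extends v w -> w * adjo v * v = v.
Proof.
move=> vv [_ /eqP]; rewrite mulrBl subr_eq0 => /eqP ->; exact: vv.
Qed.

Lemma extends_range v w : is_pisom v -> extends v w -> v * adjo v * w = v.
Proof.
move=> vv [/(congr1 (@adjo _ _ _)) + _]; rewrite adjoM adjoK adjo0.
move/eqP; rewrite mulrBr subr_eq0 => /eqP h.
by rewrite -mulrA h mulrA.
Qed.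

Lemma extends_trans v w z : is_pisom v ->
  extends v w -> extends w z -> extends v z.
Proof.
move=> vv vw [h1 h2]; have [h3 h4] := vw.
have zv : z - v = (z - w) + (w - v) by rewrite addrA subrK.
rewrite /extends zv adjoD [_ * v]mulrDl [_ * adjo v]mulrDl h3 h4 !addr0; split.
  by rewrite -(extends_source vv vw) !mulrA h1 !mul0r.
by rewrite -(extends_range vv vw) !adjoM adjoK !mulrA h2 !mul0r.
Qed.

(** What comparison uses of [M] and [tau], restated on [bop]. Closure is sequential and strong
    because limits of contractions are the only ones taken. *)
Record traced_factor (M : set bop) (tau : bop -> R[i]) : Prop := {
  tf1 : M 1 ;
  tfD : forall x y, M x -> M y -> M (x + y) ;
  tfZ : forall (a : R[i]) x, M x -> M (a *: x) ;
  tfM : forall x y, M x -> M y -> M (x * y) ;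
  tfA : forall x, M x -> M (adjo x) ;
  tf_closed : sot_closed M ;
  tf_center : forall z, M z -> (forall x, M x -> z * x = x * z) ->
    exists a : R[i], z = a *: (1 : bop) ;
  tf_linear : forall (a : R[i]) x y, M x -> M y ->
    tau (a *: x + y) = a * tau x + tau y ;
  tf_trace : forall x y, M x -> M y -> tau (x * y) = tau (y * x) ;
  tf_pos : forall x, M x -> 0 <= tau (adjo x * x) ;
  tf_faithful : forall x, M x -> tau (adjo x * x) = 0 -> x = 0 ;
  tf_unit : tau 1 = 1 }.

Context {M : set bop} {tau : bop -> R[i]}.
Hypothesis F : traced_factor M tau.

Let M1 := tf1 F.
Let MD := tfD F.
Let MZ := tfZ F.
Let MM := tfM F.
Let MA := tfA F.

Lemma tf0 : M 0. Proof. by rewrite -(scale0r (1 : bop)); exact: MZ. Qed.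

Lemma tfN x : M x -> M (- x).
Proof. by move=> Mx; rewrite -scaleN1r; exact: MZ. Qed.

Lemma tfB x y : M x -> M y -> M (x - y).
Proof. by move=> Mx My; apply: MD => //; exact: tfN. Qed.

Lemma tauD x y : M x -> M y -> tau (x + y) = tau x + tau y.
Proof. by move=> Mx My; rewrite -[x]scale1r (tf_linear F)// mul1r scale1r. Qed.

Lemma tau0 : tau 0 = 0.
Proof. by apply: (addrI (tau 0)); rewrite -tauD ?addr0//; exact: tf0. Qed.

Lemma tauN x : M x -> tau (- x) = - tau x.
Proof.
move=> Mx; apply/eqP; rewrite -addr_eq0 -tauD ?addNr ?tau0//; exact: tfN.
Qed.

Lemma tauB x y : M x -> M y -> tau (x - y) = tau x - tau y.
Proof. by move=> Mx My; rewrite tauD ?tauN//; exact: tfN. Qed.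

Lemma tau_proj_ge0 e : M e -> is_proj e -> 0 <= tau e.
Proof. by move=> Me [ee ea]; rewrite -ee -{1}ea; exact: tf_pos F _ Me. Qed.

Lemma tau_proj_eq0 e : M e -> is_proj e -> tau e = 0 -> e = 0.
Proof.
by move=> Me [ee ea] te; apply: (tf_faithful F Me); rewrite ea ee.
Qed.

Lemma tau_proj_le e f : M e -> M f -> is_proj e -> is_proj f -> e * f = f ->
  tau f <= tau e.
Proof.
move=> Me Mf pe pf ef; rewrite -subr_ge0 -tauB//.
by apply: tau_proj_ge0; [exact: tfB|exact: is_projB].
Qed.

Let mass v : R := complex.Re (tau (adjo v * v)).

Let mass_ge0 v : M v -> 0 <= mass v.
Proof.
by move=> /(tf_pos F); rewrite lecE => /andP[].
Qed.

Let mass_le1 v : M v -> is_pisom v -> mass v <= 1.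
Proof.
move=> Mv /pisom_source vv.
have Mvv : M (adjo v * v) by apply: MM => //; exact: MA.
have := tau_proj_le M1 Mvv is_proj1 vv (mul1r _).
by rewrite (tf_unit F) lecE => /andP[].
Qed.

Let mass_extends v w : M v -> M w -> extends v w ->
  mass w = mass v + mass (w - v).
Proof.
move=> Mv Mw [h1 _]; have h2 : adjo v * (w - v) = 0.
  by rewrite -[LHS]adjoK adjoM adjoK h1 adjo0.
have Mu : M (w - v) by exact: tfB.
rewrite /mass -raddfD/= -tauD; [|by apply: MM => //; exact: MA..].
congr (complex.Re (tau _));
set u := w - v in h1 h2 *; have -> : w = u + v by rewrite subrK.
clearbody u; by rewrite adjoD mulrDl !mulrDr h1 h2 addr0 add0r addrC.
Qed.

(** A countable substitute for Zorn's lemma. The n-th step picks an extension whose mass is within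
    1/(n+1) of the supremum over all extensions; the limit v extends every stage, so no proper
    extension has room for positive mass. *)
Lemma exhaustion S v0 : S v0 -> S `<=` M -> S `<=` is_pisom -> sot_closed S ->
  exists2 v, S v & forall u, S (v + u) -> adjo u * v = 0 -> u * adjo v = 0 -> u = 0.
Proof.
move=> Sv0 SM Sp Sc.
have step (nv : nat * {v | S v}) : exists w : {v | S v},
    extends (sval nv.2) (sval w) /\ forall w', S w' -> extends (sval nv.2) w' ->
      mass w' <= mass (sval w) + nv.1.+1%:R^-1.
  case: nv => n [v Sv] /=; pose E := [set mass w | w in [set w | S w /\ extends v w]].
  have Eub : ubound E 1.
    by move=> _ [w [Sw _] <-]; apply: mass_le1; [exact: SM|exact: Sp].
  have Esup : has_sup E.
    by split; [exists (mass v); exists v => //; split=> //; exact: extends_refl|exists 1].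
  have n0 : 0 < n.+1%:R^-1 :> R by rewrite invr_gt0.
  have [_ [w [Sw vw] <-] h] := sup_adherent n0 Esup.
  exists (exist _ w Sw); split=> // w' Sw' vw'; rewrite -lerBlDr.
  apply: le_trans (ltW h); rewrite lerB// ub_le_sup//; first by exists 1.
  by exists w'.
have [f fP] := choice step.
pose w0 : {v | S v} := exist _ v0 Sv0.
pose s n := sval (iteri n (fun k q => f (k, q)) w0).
have Ss n : S (s n) by exact: svalP.
have s1 n : extends (s n) (s n.+1).
  by have [] := fP (n, iteri n (fun k q => f (k, q)) w0).
have s2 n w : S w -> extends (s n) w -> mass w <= mass (s n.+1) + n.+1%:R^-1.
  by have [_] := fP (n, iteri n (fun k q => f (k, q)) w0); apply.
have sext n k : extends (s n) (s (n + k)%N).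
  elim: k => [|k ih]; first by rewrite addn0; exact: extends_refl.
  by rewrite addnS; apply: extends_trans ih (s1 _); exact/Sp.
have sle n m : (n <= m)%N -> extends (s n) (s m) by move/subnKC <-.
have sc n : contractive (s n) by exact/pisom_contractive/Sp.
have sca n : contractive (adjo (s n)) by exact/adj_contractive.
have c1 := monotone_cvg ip_norm sc.
have c2 := monotone_cvg ip_norm sca.
have [||v sv] := sot_exists ip_norm sc.
(* Along a chain the increments are orthogonal to the earlier terms, so the pairing required by
   [monotone_cvg] is exactly 0. *)
- apply: c1 => n m u /sle[h _].
  by rewrite -bopBE adjoE -bmulE h bop0E linear0r.
- apply: c2 => n m u /sle[_ h].
  by rewrite -bopBE -adjoB adjoE adjoK -bmulE h bop0E linear0r.
have Sv : S v by exact: Sc sv.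
exists v => // u Svu uv1 uv2.
have vvu : extends v (v + u) by rewrite /extends addrAC subrr add0r.
have sv_ext n : extends (s n) v.
  have svn := sot_shift n sv.
  have h1 k : 1 * s (k + n)%N * adjo (s n) = s n * adjo (s n).
    rewrite mul1r; apply/eqP; rewrite -subr_eq0 -mulrBl addnC.
    by rewrite (sext n k).2.
  have h2 k : adjo (s n) * s (k + n)%N * 1 = adjo (s n) * s n.
    rewrite mulr1; apply/eqP; rewrite -subr_eq0 -mulrBr addnC.
    by rewrite -[X in X == _]adjoK adjoM adjoK (sext n k).1 adjo0.
  have := sot_const svn h1; have := sot_const svn h2; rewrite mulr1 mul1r => e2 e1.
  split; last by rewrite mulrBl e1 subrr.
  by rewrite -[LHS]adjoK adjoM adjoK mulrBr e2 subrr adjo0.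
have Mv := SM _ Sv; have Mvu := SM _ Svu.
have Mu : M u by rewrite -[u](addKr v) addrC; apply: tfB.
have mvu : mass (v + u) = mass v + mass u.
  by rewrite (mass_extends Mv Mvu vvu) addrAC subrr add0r.
apply: (tf_faithful F Mu); have := tf_pos F Mu.
rewrite lecE/= => /andP[/eqP tim tre].
apply/eqP; rewrite eq_complex tim eqxx andbT eq_le tre andbT.
apply/ler_addgt0Pr => e e0; rewrite add0r.
have [n] : exists n, n.+1%:R^-1 < e.
  have [n _ /(_ n (leqnn n)) h] := near_infty_natSinv_lt (PosNum e0).
  by exists n.
move/ltW; apply: le_trans; rewrite -/(mass u).
(* v + u competes at stage n, hence mass v + mass u <= mass s_(n+1) + 1/(n+1), while mass s_(n+1) <=
   mass v. *)
have := s2 n (v + u) Svu (extends_trans (Sp _ (Ss n)) (sv_ext n) vvu).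
rewrite mvu (mass_extends (SM _ (Ss n.+1)) Mv (sv_ext n.+1)).
have : 0 <= mass (v - s n.+1) by apply: mass_ge0; apply: tfB => //; exact: SM.
move=> h1 h2; rewrite -(lerD2l (mass (s n.+1))); apply: le_trans h2.
by rewrite -addrA lerD2l lerDr.
Qed.

(** The x with x M e = 0 = e M x form a closed two-sided ideal [J], self-adjoint because both
    conditions are imposed. A maximal projection z of [J] is a unit for it, hence central, hence a
    scalar: either z = 0 and f = z f vanishes, or z is invertible and z e = 0 kills e. *)
Lemma factor_prime e f : M e -> M f -> is_proj e -> is_proj f ->
  (forall x, M x -> f * x * e = 0) -> e = 0 \/ f = 0.
Proof.
move=> Me Mf pe pf fMe; pose J : set bop := [set x | M x /\
  forall y, M y -> x * y * e = 0 /\ e * y * x = 0].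
have JM : J `<=` M by move=> x [].
have JZ (a : R[i]) x : J x -> J (a *: x).
  move=> [Mx h]; split; first exact: MZ.
  by move=> y /h[h1 h2]; rewrite -bscaleAr -!bscaleAl h1 h2 scaler0.
have JD x y : J x -> J y -> J (x + y).
  move=> [Mx hx] [My hy]; split; first exact: MD.
  move=> w Mw; have [h1 h2] := hx w Mw; have [h3 h4] := hy w Mw.
  by rewrite !mulrDl mulrDr h1 h2 h3 h4 addr0.
have JA x : J x -> J (adjo x).
  move=> [Mx h]; split; first exact: MA.
  move=> y /MA/h[h1 h2]; have [_ ea] := pe.
  split; apply: (can_inj (@adjoK _ _ _)); rewrite !adjoM adjoK ea adjo0 mulrA//.
have JMl x y : M x -> J y -> J (x * y).
  move=> Mx [My h]; split; first exact: MM.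
  move=> w Mw; have [h1 _] := h w Mw; have [_ h2] := h _ (MM Mw Mx).
  by rewrite -!mulrA (mulrA y) h1 mulr0 !mulrA -(mulrA e) h2.
have JMr x y : J x -> M y -> J (x * y).
  move=> Jx My; rewrite -[x * y]adjoK adjoM; apply: (JA); apply: JMl; first exact: MA.
  exact: JA.
have Jc : sot_closed J.
  move=> x v Jx xv; split; first by apply: tf_closed F _ _ _ xv => n; exact: JM.
  move=> y My; split.
    have := @sot_const x v 1 (y * e) 0 xv; rewrite mul1r mulrA; apply=> n.
    by rewrite mul1r mulrA; case: (Jx n) => _ /(_ y My)[].
  have := @sot_const x v (e * y) 1 0 xv; rewrite mulr1; apply=> n.
  by rewrite mulr1; case: (Jx n) => _ /(_ y My)[].
have J0 : J 0.
  by split; [exact: tf0|move=> y _; rewrite !mul0r mulr0].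
have Jf : J f.
  split=> // y My; split; first exact: fMe.
  apply: (can_inj (@adjoK _ _ _)); rewrite !adjoM pe.2 pf.2 adjo0 mulrA.
  by apply: fMe; exact: MA.
have [z [Jz pz] zmax] : exists2 z, J z /\ is_proj z &
    forall u, J (z + u) /\ is_proj (z + u) ->
      adjo u * z = 0 -> u * adjo z = 0 -> u = 0.
  apply: (@exhaustion [set z | J z /\ is_proj z] 0).
  - by split=> //; exact: is_proj0.
  - by move=> x [/JM].
  - by move=> x [_ /is_proj_pisom].
  - move=> x v h xv; split; first by apply: Jc xv => n; case: (h n).
    by apply: sot_proj xv _ => n; case: (h n).
have Mz := JM _ Jz.
have Jz1 x : J x -> x * z = x.
  move=> Jx; apply: contrapT => xz.
  pose K : set bop := [set y | J y /\ y * z = 0].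
  have Kx : K (x - x * z).
    split; last by rewrite mulrBl -mulrA pz.1 subrr.
    by rewrite -scaleN1r; apply: JD => //; apply: JZ; apply: JMr.
  have [|||||u [[Ju uz] u0 uu]] := @polar_part _ _ ip ip_norm K _ _ _ _ _ Kx.
  - by move=> a y [Jy yz]; split; [exact: JZ|rewrite -bscaleAl yz scaler0].
  - by move=> y w [Jy yz] [Jw wz]; split; [exact: JD|rewrite mulrDl yz wz addr0].
  - move=> y [Jy yz]; split; last by rewrite -mulrA yz mulr0.
    apply: (JMr); last exact: JM.
    by apply: JMr => //; apply: MA; exact: JM.
  - move=> y v h yv; split; first by apply: Jc yv => n; case: (h n).
    have := @sot_const y v 1 z 0 yv; rewrite mul1r; apply=> n.
    by rewrite mul1r; case: (h n).
  - by move/eqP; rewrite subr_eq0 => /eqP/esym.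
  have pg := pisom_source uu; apply: u0; rewrite -uu -mulrA.
  have gz : adjo u * u * z = 0 by rewrite -mulrA uz mulr0.
  have zg : z * (adjo u * u) = 0.
    by apply: (can_inj (@adjoK _ _ _)); rewrite adjoM pg.2 pz.2 gz adjo0.
  rewrite (zmax (adjo u * u)) ?mulr0 ?pg.2 ?pz.2//.
  split; last exact: is_projD.
  by apply: JD => //; apply: JMl => //; apply: MA; exact: JM.
have zJ x : J x -> z * x = x.
  by move=> /JA/Jz1/(congr1 (@adjo _ _ _)); rewrite adjoM adjoK pz.2.
have [a za] : exists a : R[i], z = a *: (1 : bop).
  (* Both z x and x z lie in [J], so both equal z x z. *)
  apply: (tf_center F Mz) => x Mx.
  by rewrite -(Jz1 _ (JMr _ _ Jz Mx)) -mulrA (zJ _ (JMl _ _ Mx Jz)).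
have ze : z * e = 0 by have [_ /(_ 1 M1)[]] := Jz; rewrite mulr1.
have zf : z * f = f by exact: zJ.
have [a0|a0] := eqVneq a 0.
  by right; rewrite -zf za a0 scale0r mul0r.
left; apply/eqP; rewrite -(inj_eq (scalerI a0)) scaler0 -[e]mul1r bscaleAl -za.
by rewrite ze.
Qed.

(** Take v maximal among the partial isometries of f M e. Maximality leaves no nonzero partial
    isometry from the remainder e' of e to the remainder f' of f, so one remainder vanishes. *)
Lemma comparison e f : M e -> M f -> is_proj e -> is_proj f ->
  tau e <= tau f -> exists v, [/\ M v, adjo v * v = e & f * v = v].
Proof.
move=> Me Mf pe pf ef.
pose S : set bop := [set v | [/\ M v, is_pisom v, f * v = v & v * e = v]].
have [v [Mv vv fv ve] vmax] : exists2 v, S v & forall u, S (v + u) ->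
    adjo u * v = 0 -> u * adjo v = 0 -> u = 0.
  apply: (@exhaustion S 0).
  - by split; [exact: tf0|exact/is_proj_pisom/is_proj0|rewrite mulr0|rewrite mul0r].
  - by move=> x [].
  - by move=> x [].
  - move=> x v h xv; split.
    + by apply: tf_closed F _ _ _ xv => n; case: (h n).
    + by apply: sot_pisom xv _ => n; case: (h n).
    (* The equations f x = x and x e = x pass to the limit as (f - 1) x = 0 and x (e - 1) = 0. *)
    + have := @sot_const x v (f - 1) 1 0 xv.
      rewrite mulr1 mulrBl mul1r => /(_ _)/eqP; rewrite subr_eq0 => h'; apply/eqP/h' => n.
      by rewrite mulr1 mulrBl mul1r; case: (h n) => _ _ -> _; rewrite subrr.
    + have := @sot_const x v 1 (e - 1) 0 xv.
      rewrite mul1r mulrBr mulr1 => /(_ _)/eqP; rewrite subr_eq0 => h'; apply/eqP/h' => n.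
      by rewrite mul1r mulrBr mulr1; case: (h n) => _ _ _ ->; rewrite subrr.
have MAv : M (adjo v) by exact: MA.
have Ms : M (adjo v * v) by exact: MM.
have Mr : M (v * adjo v) by exact: MM.
have ps := pisom_source vv; have pr := pisom_range vv.
have es : e * (adjo v * v) = adjo v * v.
  by rewrite mulrA -{1}pe.2 -adjoM ve.
have fr : f * (v * adjo v) = v * adjo v by rewrite mulrA fv.
have pe' := is_projB pe ps es; have pf' := is_projB pf pr fr.
set e' := e - adjo v * v in pe'; set f' := f - v * adjo v in pf'.
have Me' : M e' by exact: tfB.
have Mf' : M f' by exact: tfB.
have e'v : e' * adjo v = 0.
  rewrite mulrBl -{1}ve adjoM pe.2 mulrA pe.1 -{1}pe.2 -adjoM ve.
  by rewrite -{1}vv !adjoM adjoK mulrA subrr.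
have f'v : f' * v = 0 by rewrite mulrBl fv vv subrr.
have ee' : e' * e = e'.
  have [_ se] := ps.
  by rewrite mulrBl pe.1 -mulrA ve.
have ff' : f * f' = f' by rewrite mulrBr pf.1 fr.
have K0 u : M u -> is_pisom u -> f' * u = u -> u * e' = u -> u = 0.
  move=> Mu uu f'u ue'.
  have uv : adjo u * v = 0 by rewrite -f'u adjoM pf'.2 -mulrA f'v mulr0.
  have vu : adjo v * u = 0 by rewrite -[LHS]adjoK adjoM adjoK uv adjo0.
  have uv' : u * adjo v = 0 by rewrite -ue' -mulrA e'v mulr0.
  have vu' : v * adjo u = 0 by rewrite -[LHS]adjoK adjoM adjoK uv' adjo0.
  apply: vmax => //; split.
  - exact: MD.
  - have A : (v + u) * (adjo v + adjo u) = v * adjo v + u * adjo u.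
      by rewrite mulrDl !mulrDr uv' vu' addr0 add0r.
    rewrite /is_pisom adjoD A mulrDl !mulrDr -!mulrA vu uv.
    by rewrite !mulr0 addr0 add0r !mulrA vv uu.
  - by rewrite mulrDr fv -f'u mulrA ff'.
  - by rewrite mulrDl ve -ue' -mulrA ee'.
(* A nonzero f' x e' would have a polar part in f' M e', which [K0] excludes. *)
have [e'0|f'0] : e' = 0 \/ f' = 0.
  apply: factor_prime => // x Mx; apply: contrapT => x0.
  pose K : set bop := [set y | [/\ M y, f' * y = y & y * e' = y]].
  have Kx : K (f' * x * e').
    split; first by apply: MM => //; exact: MM.
      by rewrite !mulrA pf'.1.
    by rewrite -!mulrA pe'.1.
  have [|||||u [[Mu fu ue] u0 uu]] := @polar_part _ _ ip ip_norm K _ _ _ _ _ Kx => //.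
  - move=> a y [My fy ye]; split; first exact: MZ.
      by rewrite -bscaleAr fy.
    by rewrite -bscaleAl ye.
  - move=> y w [My fy ye] [Mw fw we]; split; first exact: MD.
      by rewrite mulrDr fy fw.
    by rewrite mulrDl ye we.
  - move=> y [My fy ye]; split.
    + by apply: MM => //; apply: MM => //; exact: MA.
    + by rewrite !mulrA fy.
    + by rewrite -mulrA ye.
  - move=> x' w h xv; split.
    + by apply: tf_closed F _ _ _ xv => n; case: (h n).
    + have := @sot_const x' w (f' - 1) 1 0 xv.
      rewrite mulr1 mulrBl mul1r => /(_ _)/eqP; rewrite subr_eq0 => h'; apply/eqP/h' => n.
      by rewrite mulr1 mulrBl mul1r; case: (h n) => _ -> _; rewrite subrr.
    + have := @sot_const x' w 1 (e' - 1) 0 xv.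
      rewrite mul1r mulrBr mulr1 => /(_ _)/eqP; rewrite subr_eq0 => h'; apply/eqP/h' => n.
      by rewrite mul1r mulrBr mulr1; case: (h n) => _ _ ->; rewrite subrr.
  by apply: u0; exact: K0.
- by exists v; split=> //; apply/esym/eqP; rewrite -subr_eq0; apply/eqP.
exists v; split=> //; apply/esym/eqP; rewrite -subr_eq0; apply/eqP.
(* When f' = 0, traciality gives tau e' = tau e - tau f <= 0. *)
apply: tau_proj_eq0 => //; apply/eqP; rewrite eq_le tau_proj_ge0// andbT.
rewrite tauB// subr_le0 (tf_trace F)//; move/eqP: f'0.
by rewrite subr_eq0 => /eqP <-.
Qed.

End Comparison.

(** * Partial isometries with a common source *)

Section Frames.
Context {R : realType} {H : completeNormedModType R[i]}.
Context {ip : {dot H for (@Num.conj R[i])}}.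
Hypothesis ip_norm : forall u : H, ip u u = `|u| ^+ 2.
Local Notation bop := (bop ip).
Implicit Types (x y z v w e f q : bop) (s L : seq bop).
Context {M : set bop} {tau : bop -> R[i]}.
Hypothesis F : traced_factor M tau.

Definition rtau x : R := complex.Re (tau x).

Lemma rtauE e : M e -> is_proj e -> tau e = (rtau e)%:C.
Proof.
by move=> Me pe; rewrite RRe_real// ger0_real// (tau_proj_ge0 F).
Qed.

Lemma rtauD x y : M x -> M y -> rtau (x + y) = rtau x + rtau y.
Proof. by move=> Mx My; rewrite /rtau (tauD F)// raddfD. Qed.

Lemma rtauB x y : M x -> M y -> rtau (x - y) = rtau x - rtau y.
Proof. by move=> Mx My; rewrite /rtau (tauB F)// raddfB. Qed.

Lemma rtau1 : rtau 1 = 1. Proof. by rewrite /rtau (tf_unit F). Qed.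

Lemma rtau0 : rtau 0 = 0. Proof. by rewrite /rtau (tau0 F). Qed.

Lemma rtau_ge0 e : M e -> is_proj e -> 0 <= rtau e.
Proof. by move=> Me pe; rewrite -lecR -rtauE// (tau_proj_ge0 F). Qed.

Lemma rtau_eq0 e : M e -> is_proj e -> rtau e = 0 -> e = 0.
Proof.
by move=> Me pe h; apply: (tau_proj_eq0 F Me pe); rewrite rtauE// h.
Qed.

Lemma rtau_le e f : M e -> M f -> is_proj e -> is_proj f -> e * f = f ->
  rtau f <= rtau e.
Proof.
by move=> Me Mf pe pf ef; rewrite -lecR -!rtauE//; exact: (tau_proj_le F).
Qed.

Context {k : nat} {p : bop}.
Hypothesis k_gt0 : (0 < k)%N.
Hypothesis Mp : M p.
Hypothesis pp : is_proj p.
Hypothesis tp : rtau p = k%:R^-1.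

(** The products v w' with v, w in [s] are matrix units over pMp. [pairwise] tests one order only;
    the other follows by taking adjoints. *)
Definition frame s := (forall v, v \in s -> M v /\ adjo v * v = p) /\
  pairwise (fun v w => adjo v * w == 0) s.

Definition span_proj s := \sum_(v <- s) v * adjo v.

Lemma frame_source v : adjo v * v = p -> v * p = v.
Proof.
move=> vp; apply/eqP; rewrite -subr_eq0; apply/eqP; apply: mul_adj_eq0.
rewrite adjoB adjoM pp.2 mulrBr !mulrBl -!mulrA vp (mulrA (adjo v)) vp.
by rewrite !pp.1 subrr.
Qed.

Lemma frame_pisom v : adjo v * v = p -> is_pisom v.
Proof. by move=> vp; rewrite /is_pisom -mulrA vp frame_source. Qed.

Lemma frame_cons v s : frame (v :: s) <-> [/\ M v, adjo v * v = p,
  forall w, w \in s -> adjo v * w = 0 & frame s].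
Proof.
split=> [[h] /=/andP[/allP vs sp]|[Mv vp vs [h sp]]].
  have [|Mv vp] := h v; first by rewrite mem_head.
  split=> //; first by move=> w /vs/eqP.
  by split=> // w ws; apply: h; rewrite inE ws orbT.
split; first by move=> w; rewrite inE => /orP[/eqP->//|/h].
by rewrite /= sp andbT; apply/allP => w /vs ->.
Qed.

Lemma frame_cat s1 s2 : frame s1 -> frame s2 ->
  (forall v w, v \in s1 -> w \in s2 -> adjo v * w = 0) -> frame (s1 ++ s2).
Proof.
move=> [h1 p1] [h2 p2] c; split.
  by move=> v; rewrite mem_cat => /orP[/h1|/h2].
rewrite pairwise_cat p1 p2 !andbT; apply/allrelP => v w vs ws.
by apply/eqP; exact: c.
Qed.

Lemma frame_filter (a : pred bop) s : frame s -> frame (seq.filter a s).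
Proof.
move=> [h ps]; split; last exact: pairwise_filter.
by move=> v; rewrite mem_filter => /andP[_ /h].
Qed.

Lemma span_proj_mem s : frame s -> [/\ M (span_proj s), is_proj (span_proj s),
  rtau (span_proj s) = (size s)%:R / k%:R &
  forall v, v \in s -> span_proj s * v = v].
Proof.
elim: s => [|v s ih].
  move=> _; rewrite /span_proj big_nil mul0r rtau0; split=> //.
    exact: (tf0 F).
  exact: is_proj0.
move=> /frame_cons[Mv vp vs /ih[Ms prs ts sv]].
rewrite /span_proj big_cons -/(span_proj s).
have Mr : M (v * adjo v) by apply: (tfM F) => //; exact: (tfA F).
have pr := pisom_range (frame_pisom vp).
have vs0 : adjo v * span_proj s = 0.
  rewrite /span_proj big_distrr/= big_seq big1// => w /vs h.
  by rewrite mulrA h mul0r.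
have rs0 : v * adjo v * span_proj s = 0 by rewrite -mulrA vs0 mulr0.
split.
- exact: (tfD F).
- exact: is_projD.
- rewrite rtauD// ts /= -addn1 natrD mulrDl addrC; congr (_ + _).
  by rewrite /rtau (tf_trace F)//; [rewrite vp -/(rtau p) tp div1r|exact: (tfA F)].
move=> w; rewrite inE mulrDl => /orP[/eqP->|ws].
  rewrite (frame_pisom vp) -[X in _ + X](_ : 0 = _) ?addr0//.
  by apply: (can_inj (@adjoK _ _ _)); rewrite adjoM prs.2 vs0 adjo0.
by rewrite sv// -mulrA vs// mulr0 add0r.
Qed.

Lemma frame_size s q : frame s -> M q -> is_proj q ->
  (forall v, v \in s -> q * v = v) -> (size s)%:R / k%:R <= rtau q.
Proof.
move=> fs Mq pq qs; have [Ms ps <- _] := span_proj_mem fs.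
apply: rtau_le => //; rewrite /span_proj big_distrr/=.
by apply: eq_big_seq => v /qs; rewrite mulrA => ->.
Qed.

Lemma span_proj_under s q : (forall v, v \in s -> q * v = v) ->
  q * span_proj s = span_proj s.
Proof.
move=> h; rewrite /span_proj big_distrr/=.
by apply: eq_big_seq => v /h; rewrite mulrA => ->.
Qed.

Lemma packing q : M q -> is_proj q -> exists s, [/\ frame s,
  forall v, v \in s -> q * v = v & rtau (q - span_proj s) < k%:R^-1].
Proof.
move=> Mq pq.
have k0 : 0 < k%:R :> R by rewrite ltr0n.
(* n bounds the number of copies of [p] that fit under q; each copy removed lowers the trace by
   1/k. *)
have [n] : exists n, rtau q < n.+1%:R / k%:R.
  exists (Num.bound (rtau q * k%:R)); rewrite ltr_pdivlMr//.
  apply: lt_trans (archi_boundP _) _; last by rewrite ltr_nat.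
  by rewrite mulr_ge0// rtau_ge0.
elim: n => [|n ih] in q Mq pq *.
  move=> h; exists [::]; split=> //.
  by rewrite /span_proj big_nil subr0 -div1r.
have [h _|h hn] := ltP (rtau q) k%:R^-1.
  by exists [::]; split=> //; rewrite /span_proj big_nil subr0.
have [|v [Mv vp qv]] := comparison ip_norm F Mp Mq pp pq.
  by rewrite !rtauE// lecR tp.
have pr := pisom_range (frame_pisom vp).
have Mr : M (v * adjo v) by apply: (tfM F) => //; exact: (tfA F).
have qr : q * (v * adjo v) = v * adjo v by rewrite mulrA qv.
have Mq' : M (q - v * adjo v) by exact: (tfB F).
have pq' := is_projB pq pr qr.
have tq' : rtau (q - v * adjo v) = rtau q - k%:R^-1.
  rewrite rtauB//; congr (_ - _).
  by rewrite /rtau (tf_trace F)//; [rewrite vp -/(rtau p) tp|exact: (tfA F)].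
have [|s [fs qs ts]] := ih _ Mq' pq'.
  by rewrite tq' ltrBlDr -[X in _ + X]div1r -mulrDl natr1.
exists (v :: s); split.
- apply/frame_cons; split=> // w /qs <-; rewrite mulrA mulrBr mulrA vp.
  by rewrite -{1}pq.2 -adjoM qv -{1}pp.2 -adjoM (frame_source vp) subrr mul0r.
- move=> w; rewrite inE => /orP[/eqP->//|/qs <-].
  by rewrite mulrA mulrBr pq.1 qr.
by rewrite /span_proj big_cons opprD addrA.
Qed.

Lemma packing_seq L : (forall q, q \in L -> M q /\ is_proj q) ->
  pairwise (fun q q' => q * q' == 0) L ->
  exists s, [/\ frame s, forall v, v \in s -> exists2 q, q \in L & q * v = v &
    rtau (\sum_(q <- L) q) - (size s)%:R / k%:R <= (size L)%:R / k%:R].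
Proof.
elim: L => [|q L ih] hL.
  by exists [::]; split=> //; rewrite big_nil rtau0 mul0r subr0.
move=> /=/andP[/allP qL pL].
have [|s [fs sL ts]] := ih _ pL; first by move=> e eL; apply: hL; rewrite inE eL orbT.
have [Mq pq] : M q /\ is_proj q by apply: hL; rewrite mem_head.
have [s' [fs' qs' ts']] := packing Mq pq.
have [Ms' ps' rs' _] := span_proj_mem fs'.
have MS : M (\sum_(q <- L) q).
  rewrite big_seq; elim/big_ind: _ => [|x y|e eL]; first exact: (tf0 F).
    exact: (tfD F).
  by have [] := hL e; rewrite ?inE ?eL ?orbT.
exists (s' ++ s); split.
- apply: frame_cat => // v w /qs' <- /sL[e eL <-].
  by rewrite adjoM pq.2 -mulrA (mulrA q) (eqP (qL _ eL)) mul0r mulr0.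
- move=> v; rewrite mem_cat => /orP[/qs' h|/sL[e eL h]].
    by exists q; rewrite ?mem_head.
  by exists e; rewrite ?inE ?eL ?orbT.
rewrite big_cons rtauD// size_cat /= -[in leRHS]add1n !natrD !mulrDl opprD addrACA.
by apply: lerD => //; rewrite -rs' div1r -rtauB// ltW.
Qed.

(** [s1] packs each element of [L] separately; [s2] packs what remains without regard to [L]. *)
Lemma frame_partition L : (forall q, q \in L -> M q /\ is_proj q) ->
  pairwise (fun q q' => q * q' == 0) L -> \sum_(q <- L) q = 1 ->
  exists s1 s2, [/\ frame (s1 ++ s2), span_proj (s1 ++ s2) = 1,
    size (s1 ++ s2) = k, forall v, v \in s1 -> exists2 q, q \in L & q * v = v &
    (size s2 <= size L)%N].
Proof.
move=> hL pL sL; have [s1 [f1 h1 t1]] := packing_seq hL pL.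
have k0 : 0 < k%:R :> R by rewrite ltr0n.
have kk : k%:R / k%:R = 1 :> R by rewrite divff// gt_eqF.
have [Ms1 p1 r1 v1] := span_proj_mem f1.
have pr := is_projC p1.
have Mr : M (1 - span_proj s1) by apply: (tfB F) => //; exact: (tf1 F).
have [s2 [f2 h2 t2]] := packing Mr pr.
have [Ms2 p2 r2 v2] := span_proj_mem f2.
have t2' : rtau (1 - span_proj s1 - span_proj s2) =
    1 - (size s1)%:R / k%:R - (size s2)%:R / k%:R.
  by rewrite rtauB// rtauB ?r1 ?r2 ?rtau1//; exact: (tf1 F).
have pz := is_projB pr p2 (span_proj_under h2).
have Mz : M (1 - span_proj s1 - span_proj s2) by exact: (tfB F).
(* The final remainder has trace a multiple of 1/k that is nonnegative and less than 1/k, hence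
   zero. *)
have sz : size (s1 ++ s2) = k.
  apply/eqP; rewrite size_cat eqn_leq; apply/andP; split.
    have := rtau_ge0 Mz pz; rewrite t2' -{1}kk -!mulrBl pmulr_lge0 ?invr_gt0//.
    by rewrite -addrA -opprD -natrD subr_ge0 ler_nat.
  have := t2; rewrite t2' -{1}kk -!mulrBl -[X in _ < X]div1r ltr_pM2r ?invr_gt0//.
  by rewrite -addrA -opprD -natrD ltrBlDl natr1 ltr_nat ltnS.
exists s1, s2; split=> //.
- apply: frame_cat => // v w vs /h2 <-.
  by rewrite mulrA mulrBr mulr1 -{1}p1.2 -adjoM v1// subrr mul0r.
- rewrite /span_proj big_cat/= -!/(span_proj _); apply/esym/eqP.
  rewrite -subr_eq0 opprD addrA; apply/eqP; apply: rtau_eq0 => //.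
  by rewrite t2' -addrA -opprD -mulrDl -natrD -size_cat sz kk subrr.
rewrite -(ler_nat R) -(@ler_pM2r _ k%:R^-1) ?invr_gt0//.
apply: le_trans t1; rewrite sL rtau1 lerBrDl -mulrDl -natrD -size_cat sz kk.
by [].
Qed.

Definition ncompr s x : nat :=
  (\sum_(v <- s) \sum_(w <- s) (adjo v * x * w != 0)%R)%N.

Lemma count_compressions L s1 s2 x :
  (forall q, q \in L -> M q /\ is_proj q) -> frame (s1 ++ s2) ->
  size (s1 ++ s2) = k -> (forall v, v \in s1 -> exists2 q, q \in L & q * v = v) ->
  (size s2 <= size L)%N ->
  (ncompr (s1 ++ s2) x)%:R <=
  (\sum_(q <- L) \sum_(q' <- L | q * x * q' != 0) rtau q * rtau q') * k%:R ^+ 2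
    + 2 * (size L * k)%:R.
Proof.
move=> hL fs sz h1 h2; set s := s1 ++ s2 in fs sz *.
have k0 : 0 < k%:R :> R by rewrite ltr0n.
(* The ranges counted are orthogonal, lie under q and have trace 1/k each, so n q <= k tau(q). *)
pose n q := count (fun v => q * v == v) s1.
have nq q : q \in L -> (n q)%:R <= rtau q * k%:R.
  move=> qL; rewrite -ler_pdivrMr//; have [Mq pq] := hL _ qL.
  rewrite /n -size_filter; apply: frame_size => //.
    have -> : s1 = take (size s1) s by rewrite take_size_cat.
    apply: frame_filter; have [f1 f2] := fs; split.
      by move=> v /mem_take/f1.
    exact: (subseq_pairwise (take_subseq _ _)).
  by move=> v; rewrite mem_filter => /andP[/eqP].
(* If v is under q and w under q', then v' x w = v' (q x q') w, so a nonzero compression forces q x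
   q' to be nonzero. Counting a pair more than once does no harm to an upper bound. *)
have main : (\sum_(v <- s1) \sum_(w <- s1) (adjo v * x * w != 0)%R <=
    \sum_(q <- L) \sum_(q' <- L | (q * x * q' != 0)%R) n q * n q')%N.
  have nE q : n q = (\sum_(v <- s1) (q * v == v)%R)%N.
    by rewrite /n -sum1_count big_mkcond; apply: eq_bigr => v _; case: eqP.
  have -> : (\sum_(q <- L) \sum_(q' <- L | (q * x * q' != 0)%R) n q * n q' =
      \sum_(v <- s1) \sum_(w <- s1) \sum_(q <- L)
        \sum_(q' <- L | (q * x * q' != 0)%R) (q * v == v)%R * (q' * w == w)%R)%N.
    under eq_bigr => q _.
      under eq_bigr => q' _ do rewrite !nE big_distrlr/=.
      rewrite exchange_big/=.
      under eq_bigr => v _ do rewrite exchange_big/=.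
      over.
    rewrite exchange_big/=; apply: eq_bigr => v _.
    by rewrite exchange_big.
  rewrite big_seq [leqRHS]big_seq; apply: leq_sum => v vs.
  rewrite big_seq [leqRHS]big_seq; apply: leq_sum => w ws.
  have [//|a0] := eqVneq (adjo v * x * w) 0.
  rewrite lt0n sum_nat_seq_eq0; apply/allPn.
  have [q qL qv] := h1 _ vs; have [q' q'L qw] := h1 _ ws.
  exists q => //=; rewrite sum_nat_seq_eq0; apply/allPn; exists q' => //=.
  rewrite qv qw !eqxx/= implybF negbK; apply: contraNneq a0 => h.
  rewrite -qv -qw adjoM (hL _ qL).2.2 -!mulrA (mulrA x) (mulrA q) (mulrA q).
  by rewrite h mul0r mulr0.
(* Every pair involving [s2] is counted as if it were nonzero: at most [size L] rows and as many
   columns of length k. *)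
have split_sum : (ncompr s x <=
    \sum_(v <- s1) \sum_(w <- s1) (adjo v * x * w != 0)%R + 2 * (size L * k))%N.
  have le1 (a b : seq bop) :
      (\sum_(v <- a) \sum_(w <- b) (adjo v * x * w != 0)%R <= size a * size b)%N.
    elim: a => [|v a ih]; rewrite ?big_nil// big_cons mulSn leq_add//.
    by rewrite -sum1_size; apply: leq_sum => w _; exact: leq_b1.
  have s1k : (size s1 <= k)%N by rewrite -sz size_cat leq_addr.
  rewrite /ncompr {1}/s big_cat/=.
  have -> : (\sum_(v <- s1) \sum_(w <- s) (adjo v * x * w != 0)%R =
      \sum_(v <- s1) \sum_(w <- s1) (adjo v * x * w != 0)%R +
      \sum_(v <- s1) \sum_(w <- s2) (adjo v * x * w != 0)%R)%N.
    by rewrite -big_split/=; apply: eq_bigr => v _; rewrite /s big_cat.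
  rewrite -addnA leq_add2l mul2n -addnn; apply: leq_add.
    by apply: leq_trans (le1 _ _) _; rewrite mulnC leq_mul.
  by apply: leq_trans (le1 _ _) _; rewrite sz leq_mul.
apply: le_trans (_ : (\sum_(q <- L) \sum_(q' <- L | (q * x * q' != 0)%R) n q * n q'
    + 2 * (size L * k))%N%:R <= _).
  by rewrite ler_nat; apply: leq_trans split_sum _; rewrite leq_add2r.
rewrite natrD [in leRHS]natrM -natrM -[X in _ + X * _]/(2%:R) -natrM lerD2r.
rewrite natr_sum mulr_suml big_seq [leRHS]big_seq; apply: ler_sum => q qL.
rewrite natr_sum mulr_suml big_seq_cond [leRHS]big_seq_cond.
apply: ler_sum => q' /andP[q'L _].
by rewrite natrM expr2 mulrACA ler_pM// nq.
Qed.

End Frames.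

(** * Von Neumann algebras generated by compressions *)

Lemma ler_sum_undup (R : numDomainType) (T : eqType) (s : seq T) (f : T -> R) :
  (forall x, 0 <= f x) -> \sum_(x <- undup s) f x <= \sum_(x <- s) f x.
Proof.
move=> f0; elim: s => //= x s ih; rewrite big_cons.
case: ifP => _; last by rewrite big_cons lerD2l.
by apply: le_trans ih _; rewrite lerDr.
Qed.

Lemma mem_fseq (K : choiceType) (s : seq K) x :
  (x \in [fset y in s]%fset) = (x \in s).
Proof. by rewrite inE. Qed.

Lemma enum_fseq (K : choiceType) (s : seq K) :
  perm_eq (enum_fset [fset x in s]%fset) (undup s).
Proof.
apply: uniq_perm; [exact: fset_uniq|exact: undup_uniq|move=> x].
by rewrite mem_undup mem_fseq.
Qed.

Section VonNeumannAlgebras.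
Context {R : realType} {H : completeNormedModType R[i]}.
Context {ip : {dot H for (@Num.conj R[i])}}.
Hypothesis ip_norm : forall u : H, ip u u = `|u| ^+ 2.
Local Notation bop := (bop ip).
Implicit Types (x y z v w e q : bop) (f g : H -> H) (K N S : set (H -> H)).

(** The default 0 is never met on members of a von Neumann algebra, which are adjointable. *)
Definition tobop f : bop := insubd 0 f.

Lemma tobopK f : f \in adjointable ip -> tobop f = f :> (H -> H).
Proof. exact: insubdK. Qed.

Lemma bvalK x : tobop x = x.
Proof. by apply: val_inj; rewrite /= tobopK//; exact: bvalP. Qed.

Section OneAlgebra.
Context {N : set (H -> H)}.
Hypothesis vN : vN_algebra ip N.

Lemma vN_adjointable f : N f -> f \in adjointable ip.
Proof.
move=> Nf; apply/adjointableP; split; first exact: (vN_bounded vN).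
by have [g Ng fg] := vN_adj vN Nf; exists g => //; exact: (vN_bounded vN).
Qed.

Lemma vN_tobop f : N f -> tobop f = f :> (H -> H).
Proof. by move=> /vN_adjointable; exact: tobopK. Qed.

Lemma vN0 : N (0 : bop). Proof. exact: vN_zero vN. Qed.

Lemma vND x y : N x -> N y -> N (x + y). Proof. exact: vN_add vN _ _. Qed.

Lemma vNZ (a : R[i]) x : N x -> N (a *: x). Proof. exact: vN_scale vN _ _. Qed.

Lemma vNM x y : N x -> N y -> N (x * y). Proof. exact: vN_mul vN _ _. Qed.

Lemma vNA x : N x -> N (adjo x).
Proof.
by move=> Nx; have [y Ny xy] := vN_adj vN Nx; rewrite (is_adjoint_uniq (adjoP x) xy).
Qed.

Lemma vNB x y : N x -> N y -> N (x - y).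
Proof. by move=> Nx Ny; apply: vND => //; rewrite -scaleN1r; exact: vNZ. Qed.

Lemma vN_sum (I : eqType) (s : seq I) (F : I -> bop) :
  (forall i, i \in s -> N (F i)) -> N (\sum_(i <- s) F i).
Proof.
move=> h; rewrite big_seq; elim/big_ind: _ => //; [exact: vN0|exact: vND].
Qed.

Lemma vN_sot_closed : sot_closed [set x : bop | N x].
Proof.
move=> x v Nx [_ l _]; apply: (vN_closed vN); split; first exact: bop_bounded.
move=> s e e0.
suff [n h] : exists n, forall uv, uv \in s -> `|ip (v uv.1 - x n uv.1) uv.2| < e.
  by exists (x n); [exact: Nx|exact: h].
have : \forall n \near \oo, forall uv, uv \in s ->
    `|ip (v uv.1 - x n uv.1) uv.2| < e.
  elim: s => [|uv s ih]; first by near=> n.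
  have h := cvg_ipl ip_norm uv.2 (l uv.1) e0.
  near=> n => uv'; rewrite inE => /orP[/eqP->|].
    by near: n; exact: h.
  by move: uv'; near: n; exact: ih.
by move=> [n _ /(_ n (leqnn n))]; exists n.
Unshelve. all: by end_near. Qed.

End OneAlgebra.

Lemma wot_closure_sub S N : S `<=` N -> wot_closure ip S `<=` wot_closure ip N.
Proof.
move=> SN f [bf h]; split=> // s e e0.
by have [x /SN Nx hx] := h s e e0; exists x.
Qed.

(** Since <a (y - f) b u, w> = <(y - f) b u, a' w>, approximating a y b on given vectors is
    approximating y on transported ones. *)
Lemma wot_closure_compress S N (a b y : bop) :
  S `<=` [set f | f \in adjointable ip /\ N (a * tobop f * b)] ->
  wot_closure ip S y -> wot_closure ip N (a * y * b).
Proof.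
move=> SN [_ h]; split; first exact: bop_bounded.
move=> s e e0.
have [f /SN[fA Nf] hf] := h [seq (b uv.1, adjo a uv.2) | uv <- s] e e0.
exists (a * tobop f * b) => // uv uvs.
rewrite !bmulE -raddfB adjoE tobopK//.
exact: (hf (_, _) (map_f _ uvs)).
Qed.

(** The tool behind every generation proof. Inserting [span_proj s] between two factors turns a
    compression of a product into a sum of products of compressions. It is applied to a full frame,
    with [span_proj s] = 1, and to a single adjoint, with [span_proj s] the unit of the corner. *)
Lemma vN_compress (s : seq bop) K N : vN_algebra ip K -> vN_algebra ip N ->
  (forall x y, K x -> K y -> x * span_proj s * y = x * y) ->
  vN_algebra ip [set f | K f /\
    forall v w, v \in s -> w \in s -> N (adjo v * tobop f * w)].
Proof.
move=> vK vN hs; split.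
- by move=> f [/(vN_bounded vK)].
- split; first exact: vN0 vK.
  move=> v w _ _; have -> : tobop (fun=> 0) = 0 by exact: (bvalK 0).
  by rewrite mulr0 mul0r; exact: vN0.
- move=> f g [Kf hf] [Kg hg]; split; first exact: (vN_add vK).
  move=> v w vs ws; rewrite -(vN_tobop vK Kf) -(vN_tobop vK Kg).
  rewrite (bvalK (tobop f + tobop g)) mulrDr mulrDl.
  by apply: vND => //; [exact: hf|exact: hg].
- move=> a f [Kf hf]; split; first exact: (vN_scale vK).
  move=> v w vs ws; rewrite -(vN_tobop vK Kf) (bvalK (a *: tobop f)).
  by rewrite -bscaleAr -bscaleAl; apply: vNZ => //; exact: hf.
- move=> f g [Kf hf] [Kg hg]; split; first exact: (vN_mul vK).
  move=> v w vs ws; rewrite -(vN_tobop vK Kf) -(vN_tobop vK Kg).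
  rewrite (bvalK (tobop f * tobop g)) -(hs (tobop f) (tobop g)) ?(vN_tobop vK)//.
  rewrite /span_proj mulr_sumr mulr_suml mulr_sumr mulr_suml.
  apply: vN_sum => // z zs; rewrite !mulrA -(mulrA _ (adjo z) (tobop g)).
  rewrite -(mulrA _ (adjo z * tobop g)); apply: vNM => //; [exact: hf|exact: hg].
- move=> f [Kf hf]; have [g Kg fg] := vN_adj vK Kf; exists g => //; split=> //.
  move=> v w vs ws.
  have -> : tobop g = adjo (tobop f).
    by apply: val_inj; rewrite /= (vN_tobop vK Kg); apply: is_adjoint_uniq fg _;
       rewrite -[f in is_adjoint _ f _](vN_tobop vK Kf); exact: adjoP.
  rewrite -[w]adjoK -!adjoM mulrA; apply: vNA => //; exact: hf.
- move=> f fc.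
  have Kf : K f by apply: (vN_closed vK); apply: wot_closure_sub fc => g [].
  split=> // v w vs ws; apply: (vN_closed vN).
  apply: wot_closure_compress; last by rewrite (vN_tobop vK Kf); exact: fc.
  by move=> g [Kg hg]; split; [exact: vN_adjointable vK _ Kg|exact: hg].
Qed.

(** The ambient [K] supplies boundedness and an adjoint; adjoints being unique, it lies in every
    algebra of the intersection. *)
Lemma W_star_vN S K : vN_algebra ip K -> S `<=` K -> vN_algebra ip (W_star ip S).
Proof.
move=> vK SK; have WK : W_star ip S `<=` K by move=> f; apply; split.
split.
- by move=> f /WK/(vN_bounded vK).
- by move=> N [vN _]; exact: (vN_zero vN).
- by move=> f g Wf Wg N NS; apply: (vN_add NS.1); [exact: Wf|exact: Wg].
- by move=> a f Wf N NS; apply: (vN_scale NS.1); exact: Wf.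
- by move=> f g Wf Wg N NS; apply: (vN_mul NS.1); [exact: Wf|exact: Wg].
- move=> f Wf; have [g Kg fg] := vN_adj vK (WK _ Wf); exists g => // N NS.
  have [g' Ng' fg'] := vN_adj NS.1 (Wf N NS).
  by rewrite (is_adjoint_uniq fg fg').
- move=> f fc N NS; apply: (vN_closed NS.1); apply: wot_closure_sub fc.
  by move=> g; apply.
Qed.

Lemma sub_W_star S : S `<=` W_star ip S. Proof. by move=> f Sf N [_]; apply. Qed.

Lemma W_star_min S N : vN_algebra ip N -> S `<=` N -> W_star ip S `<=` N.
Proof. by move=> vN SN f; apply; split. Qed.

Section Corner.
Context {M : set (H -> H)} {p : bop}.
Hypothesis vM : vN_algebra ip M.
Hypothesis Mp : M p.
Hypothesis pp : is_proj p.

Lemma cornerE x : corner M p x <-> M x /\ p * x * p = x.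
Proof.
split=> [[f Mf xE]|[Mx px]]; last by exists x => //; rewrite -[in RHS]px.
have -> : x = p * tobop f * p by apply: val_inj; rewrite /= -xE (vN_tobop vM Mf).
split; first by apply: vNM => //; apply: vNM; rewrite ?(vN_tobop vM).
by rewrite !mulrA pp.1 -!mulrA pp.1.
Qed.

Lemma corner_vN : vN_algebra ip (corner M p).
Proof.
have pxp x : M x -> M (p * x * p) by move=> Mx; do 2?apply: vNM.
have cM : corner M p `<=` M.
  move=> _ [f Mf <-]; rewrite -(vN_tobop vM Mf); apply: (pxp (tobop f)).
  by rewrite (vN_tobop vM Mf).
have cE f : corner M p f -> p * tobop f * p = tobop f.
  move=> cf; have := (cornerE (tobop f)).1.
  by rewrite (vN_tobop vM (cM _ cf)) => /(_ cf)[].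
have cI x : M x -> p * x * p = x -> corner M p x by move=> *; exact/cornerE.
split.
- by move=> f /cM/(vN_bounded vM).
- by apply: (cI 0); [exact: vN0|rewrite mulr0 mul0r].
- move=> f g cf cg; rewrite -(vN_tobop vM (cM _ cf)) -(vN_tobop vM (cM _ cg)).
  apply: (cI (tobop f + tobop g)); last by rewrite mulrDr mulrDl !cE.
  by apply: vND => //; rewrite (vN_tobop vM); exact: cM.
- move=> a f cf; rewrite -(vN_tobop vM (cM _ cf)).
  apply: (cI (a *: tobop f)); last by rewrite -bscaleAr -bscaleAl cE.
  by apply: vNZ => //; rewrite (vN_tobop vM); exact: cM.
- move=> f g cf cg; rewrite -(vN_tobop vM (cM _ cf)) -(vN_tobop vM (cM _ cg)).
  apply: (cI (tobop f * tobop g)).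
    by apply: vNM => //; rewrite (vN_tobop vM); exact: cM.
  rewrite -{1}(cE _ cf) -{1}(cE _ cg) !mulrA pp.1 -!mulrA pp.1.
  by rewrite !mulrA (cE _ cf) -!mulrA (mulrA p) (cE _ cg).
- move=> f cf; exists (adjo (tobop f)).
    apply: cI; last by rewrite -[in RHS](cE _ cf) !adjoM pp.2 mulrA.
    by apply: vNA => //; rewrite (vN_tobop vM); exact: cM.
  by rewrite -[f in is_adjoint _ f _](vN_tobop vM (cM _ cf)); exact: adjoP.
- move=> f fc.
  have Mf : M f by apply: (vN_closed vM); exact: wot_closure_sub cM _ fc.
  rewrite -(vN_tobop vM Mf); apply: cI; first by rewrite (vN_tobop vM).
  rewrite -(vN_tobop vM Mf) in fc.
  apply: bop_ext => u; apply: (ip_extl (ip := ip)) => w.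
  apply/eqP; rewrite -subr_eq0 -normr_le0; apply/ler_addgt0Pr => e e0; rewrite add0r.
  have e2 : 0 < e / 2 by rewrite divr_gt0.
  (* g approximates f at (u, w) and at (p u, p w), and p g p = g; so p f p and f agree up to e at
     (u, w). *)
  have [g cg hg] := fc.2 [:: (u, w); (p u, p w)] _ e2.
  have -> : ip ((p * tobop f * p) u) w - ip (tobop f u) w =
      ip (tobop f (p u) - tobop g (p u)) (p w) - ip (tobop f u - tobop g u) w.
    have ipB (a b c : H) : ip (a - b) c = ip a c - ip b c by rewrite linearBl.
    have pE h : ip (bval h (p u)) (p w) = ip ((p * h * p) u) w.
      by rewrite !bmulE (adjoE p) pp.2.
    by rewrite !ipB !pE (cE _ cg) opprB addrA subrK.
  apply: le_trans (ler_normB _ _) _; rewrite [leRHS]splitr; apply: lerD; apply: ltW.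
    by rewrite (vN_tobop vM (cM _ cg)); apply: (hg (p u, p w)); rewrite !inE eqxx orbT.
  by rewrite (vN_tobop vM (cM _ cg)); apply: (hg (u, w)); rewrite !inE eqxx.
Qed.

End Corner.

Lemma II1_traced_factor M (tau : (H -> H) -> R[i]) : II1_factor ip M ->
  normal_faithful_trace ip M tau ->
  traced_factor [set x : bop | M x] (fun x : bop => tau x).
Proof.
move=> FM T; have vM := II1_vN FM; split=> /=.
- exact: II1_unit FM.
- exact: vND.
- exact: vNZ.
- exact: vNM.
- exact: vNA.
- exact: vN_sot_closed.
- move=> z Mz hz; have [|a za] := II1_factorial FM Mz; last first.
    by exists a; apply: val_inj.
  move=> f Mf; rewrite -(vN_tobop vM Mf).
  have Ml : M (tobop f) by rewrite (vN_tobop vM Mf).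
  exact: (congr1 (fun y : bop => y : H -> H) (hz (tobop f) Ml)).
- by move=> a x y Mx My; exact: (tau_linear T).
- by move=> x y Mx My; exact: (tau_tracial T).
- by move=> x Mx; apply: (tau_pos T Mx (vNA vM Mx)); exact: adjoP.
- move=> x Mx h; apply: val_inj.
  exact: (tau_faithful T Mx (vNA vM Mx) (adjoP x) h).
- exact: (tau_unit T).
Qed.

End VonNeumannAlgebras.

(** * From generators of a corner to generators of the factor *)

Section Generators.
Context {R : realType} {H : completeNormedModType R[i]}.
Context {ip : {dot H for (@Num.conj R[i])}}.
Hypothesis ip_norm : forall u : H, ip u u = `|u| ^+ 2.
Local Notation bop := (bop ip).
Implicit Types (x y z v w e q : bop) (f g : H -> H) (N : set (H -> H)).
Context {M : set (H -> H)} {tau : (H -> H) -> R[i]}.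
Hypothesis M_II1 : II1_factor ip M.
Hypothesis tau_trace : normal_faithful_trace ip M tau.

Let Mb : set bop := [set x : bop | M x].
Let taub : bop -> R[i] := fun x => tau x.
Let vM : vN_algebra ip M := II1_vN M_II1.
Let F : traced_factor Mb taub := II1_traced_factor ip_norm M_II1 tau_trace.

Lemma bval_eq0 x : (bval x == fun=> 0) = (x == 0).
Proof. exact: (inj_eq val_inj x 0). Qed.

Lemma projectionP e : is_proj e <-> projection ip e.
Proof.
split=> [[ee ea]|[_ ee ea]].
  split; [exact: bop_bounded|by rewrite -[in RHS]ee|].
  by rewrite -{2}ea; exact: adjoP.
by split; [exact: val_inj|exact: adjo_uniq].
Qed.

Lemma tobop_proj f : M f -> projection ip f -> Mb (tobop f) /\ is_proj (tobop f : bop).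
Proof.
by move=> Mf pf; split; [|apply/projectionP]; rewrite /Mb/= (vN_tobop vM Mf).
Qed.

Lemma bsumE (I : Type) (r : seq I) (h : I -> bop) u :
  (\sum_(i <- r) h i) u = \sum_(i <- r) h i u.
Proof.
elim: r => [|i r ih]; first by rewrite !big_nil.
by rewrite !big_cons bopDE ih.
Qed.

Lemma indexI1_ge0 f (P : {fset H -> H}) : projection_partition ip M P ->
  0 <= indexI1 tau f P.
Proof.
move=> [hP _ _]; rewrite /indexI1 big_seq; apply: sumr_ge0 => q qP.
rewrite big_seq_cond; apply: sumr_ge0 => q' /andP[q'P _].
have h f' : f' \in P -> 0 <= complex.Re (tau f').
  move=> /hP[Me pe]; have [Ml pl] := tobop_proj Me pe.
  by have := rtau_ge0 F Ml pl; rewrite /rtau /taub (vN_tobop vM Me).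
by apply: mulr_ge0; exact: h.
Qed.

Context {k : nat} {p : bop}.
Hypothesis k_gt0 : (0 < k)%N.
Hypothesis Mp : M p.
Hypothesis pp : is_proj p.
Hypothesis tp : complex.Re (tau p) = k%:R^-1.

Local Notation frame := (@frame _ _ ip Mb p).

Definition frame_ranges (s : seq bop) : {fset H -> H} :=
  [fset f in [seq bval (v * adjo v) | v <- s]]%fset.

(** A zero range would give tau p = 0 by traciality, against 1/k. Hence distinct positions in a
    frame give distinct ranges. *)
Lemma frame_neq0 s v : frame s -> v \in s -> v * adjo v != 0.
Proof.
move=> [h _] /h[Mv vp]; apply/eqP => v0.
have := tf_trace F Mv (tfA F Mv); rewrite v0 vp (tau0 F).
move/(congr1 (@complex.Re _)) => /eqP; rewrite /= tp eq_sym invr_eq0.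
by rewrite pnatr_eq0 gtn_eqF.
Qed.

Lemma frame_range_sq s v : frame s -> v \in s ->
  v * adjo v * (v * adjo v) = v * adjo v.
Proof. by move=> fs /(fs.1)[_ /(frame_pisom pp)/pisom_range[]]. Qed.

Lemma frame_ranges_uniq s : frame s ->
  uniq [seq bval (v * adjo v) | v <- s].
Proof.
move=> fs; have := fs; rewrite uniq_pairwise pairwise_map => -[h].
apply: (sub_in_pairwise _ (allss s)) => v w vs ws /eqP vw.
apply/eqP => /val_inj e; have := frame_neq0 fs vs; rewrite -(frame_range_sq fs vs) {2}e.
by rewrite mulrA -(mulrA v) vw mulr0 mul0r eqxx.
Qed.

Lemma frame_orth s v w : frame s -> v \in s -> w \in s -> v != w -> adjo v * w = 0.
Proof.
elim: s => // a s ih /frame_cons[Ma ap as0 fs].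
rewrite !inE => /predU1P[->|vs] /predU1P[->|ws]; rewrite ?eqxx// => vw.
- exact: as0.
- by rewrite -[LHS]adjoK adjoM adjoK as0// adjo0.
- exact: ih.
Qed.

Lemma frame_ranges_partition s : frame s -> span_proj s = 1 ->
  projection_partition ip M (frame_ranges s).
Proof.
move=> fs s1; split.
- move=> f; rewrite mem_fseq => /mapP[v vs ->].
  have [Mv vp] := fs.1 _ vs; split.
    by apply: vNM => //; exact: vNA.
  by apply/projectionP; exact/pisom_range/(frame_pisom pp vp).
- move=> f g; rewrite !mem_fseq => /mapP[v vs ->] /mapP[w ws ->] vw.
  have vw' : v != w by apply: contraNneq vw => ->.
  have -> : (v * adjo v) \o (w * adjo w) = (v * (adjo v * w) * adjo w : bop) by [].
  by rewrite (frame_orth fs)// mulr0 mul0r.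
move=> u; rewrite (perm_big _ (enum_fseq _)) undup_id ?frame_ranges_uniq//.
by rewrite big_map -bsumE -/(span_proj s) s1.
Qed.

(** Each cell contributes 1/k^2; [E] need only contain the cells where x is nonzero. *)
Lemma frame_index s x (E : seq (bop * bop)) : frame s -> size s = k ->
  (forall a b, a \in s -> b \in s -> adjo a * x * b != 0 -> (a, b) \in E) ->
  indexI1 tau x (frame_ranges s) <= (size E)%:R / k%:R ^+ 2.
Proof.
move=> fs sk hE; have uf := frame_ranges_uniq fs.
have us : uniq s by exact: map_uniq uf.
rewrite /indexI1 (perm_big _ (enum_fseq _)) undup_id// big_map.
have tv v : v \in s -> complex.Re (tau (v * adjo v)) = k%:R^-1.
  move=> /(fs.1)[Mv vp]; have := tf_trace F Mv (tfA F Mv).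
  by rewrite vp -tp /taub => ->.
pose c vw := adjo vw.1 * x * vw.2 != 0.
pose pairs := [seq (v, w) | v <- s, w <- s].
have up : uniq pairs by apply: allpairs_uniq => // -[? ?] [? ?].
apply: (@le_trans _ _ (\sum_(vw <- pairs | c vw) (k%:R ^+ 2)^-1)).
  rewrite /pairs [leRHS]big_mkcond [leRHS]big_allpairs big_seq [leRHS]big_seq.
  apply: ler_sum => v vs.
  rewrite (perm_big _ (enum_fseq _)) undup_id// big_map.
  rewrite [leLHS]big_mkcond [leLHS]big_seq [leRHS]big_seq; apply: ler_sum => w ws.
  rewrite !tv//; case: ifPn => [h|_]; last by case: ifP; rewrite ?invr_ge0.
  rewrite /c /= -invfM -expr2; case: ifPn => // /negPn/eqP h0.
  move/eqP: h; case; have -> : (v * adjo v) \o x \o (w * adjo w) =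
      (v * (adjo v * x * w) * adjo w : bop) by [].
  by rewrite h0 mulr0 mul0r.
rewrite -big_filter big_const_seq iter_addr addr0 count_predT -[leLHS]mulr_natl.
rewrite ler_wpM2r ?invr_ge0// ler_nat.
apply: uniq_leq_size; first exact: filter_uniq.
move=> [v w]; rewrite mem_filter => /andP[h /allpairsP[[v' w'] /= [vs ws]]].
by case=> ? ?; subst; exact: hE.
Qed.

Lemma corner_generators (Y : {fset H -> H}) : generates ip (corner M p) Y ->
  exists X : {fset H -> H}, [/\ generates ip M X,
    (forall f, f \in Y -> is_adjoint ip f f) -> forall f, f \in X -> is_adjoint ip f f &
    (indexI ip M tau X <=
      ((#|` Y|%:R + 2 * k%:R) / k%:R ^+ 2 : R)%:E)%E].
Proof.
move=> [Yc WY].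
(* The trivial partition suffices here: any frame of k elements spanning 1 will do. *)
have [s1 [s2 [fs ss sz _ _]]] :
    exists s1 s2, [/\ frame (s1 ++ s2), span_proj (s1 ++ s2) = 1,
    size (s1 ++ s2) = k, forall v, v \in s1 -> exists2 q, q \in [:: 1 : bop] & q * v = v &
    (size s2 <= size [:: (1%R : bop)])%N].
  apply: (frame_partition ip_norm F) => //.
    by move=> q; rewrite inE => /eqP ->; split; [exact: tf1 F|exact: is_proj1].
  by rewrite big_seq1.
move: (s1 ++ s2) fs ss sz => {s1 s2} [|v0 s'] fs ss sz.
  by move: k_gt0; rewrite -sz.
have [Mv0 v0p v0s fs'] := (frame_cons _ _).1 fs.
set s := v0 :: s' in fs ss sz.
have fM v : v \in s -> M v by case/(fs.1).
have fp v : v \in s -> adjo v * v = p by case/(fs.1).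
have vp v : v \in s -> v * p = v by move=> /fp/(frame_source pp).
have pv v : v \in s -> p * adjo v = adjo v.
  by move=> vs; rewrite -{1}pp.2 -adjoM vp.
have v0s' : v0 \in s by rewrite mem_head.
(* Self-adjoint, yet as good as the matrix unit v v0', which is recovered as
   [t v * (v0 * adjo v0)]. *)
pose t v := v * adjo v0 + v0 * adjo v.
pose c f := v0 * tobop f * adjo v0.
pose sq := [seq bval (c f) | f <- Y] ++ [seq bval (t v) | v <- s'].
exists [fset f in sq]%fset.
have YM f : f \in Y -> M f /\ p * tobop f * p = tobop f.
  move=> /Yc cf; have := (cornerE vM Mp pp (tobop f)).1.
  by rewrite (vN_tobop (corner_vN vM Mp pp) cf) => /(_ cf).
have s's v : v \in s' -> v \in s by move=> vs; rewrite inE vs orbT.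
have Mt v : v \in s' -> M (t v).
  move=> /s's/fM Mv; apply: vND => //; apply: vNM => //; exact: vNA.
have XM : [set` [fset f in sq]%fset] `<=` M.
  move=> f /=; rewrite mem_fseq mem_cat => /orP[|] /mapP[].
    move=> g gY ->; have [Mg _] := YM _ gY.
    by apply: vNM => //; [apply: vNM => //; rewrite (vN_tobop vM Mg)|exact: vNA].
  by move=> v /Mt Mtv ->.
split.
- split=> //; apply/seteqP; split; first exact: W_star_min.
  have vN := W_star_vN vM XM; set N := W_star ip _ in vN *.
  have XN f : f \in sq -> N f by move=> fs0; apply: sub_W_star; rewrite /= mem_fseq.
  (* The y in pMp with v0 y v0' in [N] form a von Neumann algebra containing [Y], hence are all of
     pMp. *)
  have cN : corner M p `<=` [set f | corner M p f /\
      forall v w, v \in [:: adjo v0] -> w \in [:: adjo v0] -> N (adjo v * tobop f * w)].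
    rewrite -WY; apply: W_star_min.
      rewrite WY; apply: (vN_compress (s := [:: adjo v0]) (corner_vN vM Mp pp) vN).
      move=> x y /(cornerE vM Mp pp)[_ xp] _.
      by rewrite /span_proj big_seq1 adjoK v0p -{1}xp -!mulrA (mulrA p p) pp.1 !mulrA xp.
    move=> f fY; split; first exact: sub_W_star.
    move=> v w; rewrite !mem_seq1 => /eqP-> /eqP->; rewrite adjoK.
    by apply: XN; rewrite mem_cat; apply/orP; left; apply/mapP; exists f.
  have cN' x : M x -> p * x * p = x -> N (v0 * x * adjo v0).
    move=> Mx px; have /cN[_ /(_ (adjo v0) (adjo v0))] : corner M p x by exact/cornerE.
    by rewrite adjoK bvalK; apply; rewrite mem_seq1.
  have Nf0 : N (v0 * adjo v0).
    by rewrite -{1}(vp v0)//; apply: cN' => //; rewrite !pp.1.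
  have Nv v : v \in s -> N (v * adjo v0).
    rewrite inE => /orP[/eqP->//|vs'].
    have := vNM vN (XN (t v) _) Nf0; rewrite mulrDl.
    rewrite -!mulrA (mulrA _ v0) v0p (mulrA _ v0) pv//.
    have -> : adjo v * v0 = 0.
      by rewrite -[LHS]adjoK adjoM adjoK v0s// adjo0.
    rewrite mul0r mulr0 addr0; apply.
    by rewrite mem_cat; apply/orP; right; apply/mapP; exists v.
  move=> f Mf; rewrite -(vN_tobop vM Mf); set x := tobop f.
  have Mx : M x by rewrite (vN_tobop vM Mf).
  rewrite -[x]mul1r -[X in N X]/(bval _) -[1 * x]mulr1 -ss /span_proj.
  rewrite mulr_suml mulr_suml; apply: vN_sum => // a as_.
  rewrite mulr_sumr; apply: vN_sum => // b bs.
  (* Each matrix entry of x is moved to the cell of v0, where [cN'] applies, and back by the linking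
     units. *)
  have -> : a * adjo a * x * (b * adjo b) =
      a * adjo v0 * (v0 * (adjo a * x * b) * adjo v0) * (v0 * adjo b).
    by rewrite -!mulrA (mulrA (adjo v0) v0) v0p (mulrA (adjo v0) v0) v0p
      (mulrA p (adjo a)) pv// pv.
  have -> : v0 * adjo b = adjo (b * adjo v0) by rewrite adjoM adjoK.
  apply: (vNM vN); last by apply: (vNA vN); exact: Nv.
  apply: (vNM vN); first exact: Nv.
  apply: cN'; last by rewrite !mulrA pv// -!mulrA vp.
  apply: (vNM vM); last exact: fM.
  by apply: (vNM vM) => //; apply: (vNA vM); exact: fM.
- move=> Ysa f; rewrite mem_fseq mem_cat => /orP[|] /mapP[].
    move=> g gY ->; have [Mg _] := YM _ gY.
    have ga : adjo (tobop g : bop) = tobop g.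
      by apply: adjo_uniq; rewrite (vN_tobop vM Mg); exact: Ysa.
    have := adjoP (c g); rewrite {2}/c !adjoM adjoK ga mulrA; exact.
  move=> v _ ->; have := adjoP (t v).
  by rewrite {2}/t adjoD !adjoM !adjoK addrC; exact.
have pP := frame_ranges_partition fs ss.
apply: (@le_trans _ _ (indexI_at tau [fset f in sq]%fset (frame_ranges s))%:E).
  by apply: ereal_inf_lbound; exists (frame_ranges s).
rewrite lee_fin /indexI_at (perm_big _ (enum_fseq _)).
apply: le_trans (ler_sum_undup _ _) _; first by move=> f; exact: indexI1_ge0.
rewrite /sq big_cat !big_map mulrDl; apply: lerD.
  rewrite -sum1_size natr_sum mulr_suml; apply: ler_sum => f _.
  apply: le_trans (frame_index (x := c f) (E := [:: (v0, v0)]) fs sz _) _ => //.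
  move=> a b as_ bs.
  have orth a' : a' \in s' -> adjo a' * v0 = 0.
    by move=> /v0s h; rewrite -[LHS]adjoK adjoM adjoK h adjo0.
  rewrite /c; case/predU1P: as_ => [->|/orth h]; last by rewrite !mulrA h !mul0r eqxx.
  case/predU1P: bs => [->|/v0s h]; last by rewrite -!mulrA h !mulr0 eqxx.
  by rewrite mem_head.
(* There are k - 1 linking elements with two cells each; the term of v0 is slack. *)
have -> : 2 * k%:R / k%:R ^+ 2 = \sum_(v <- s) 2 / k%:R ^+ 2 :> R.
  by rewrite big_const_seq count_predT iter_addr addr0 sz -[RHS]mulr_natl mulrA (mulrC 2).
rewrite /s big_cons; apply: le_trans (_ : \sum_(v <- s') 2 / k%:R ^+ 2 <= _); last first.
  by rewrite lerDr divr_ge0.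
rewrite big_seq [leRHS]big_seq; apply: ler_sum => v vs'.
apply: le_trans (frame_index (E := [:: (v, v0); (v0, v)]) fs sz _) _ => // a b as_ bs.
apply: contraNT; rewrite !inE !xpair_eqE negb_or => /andP[n1 n2].
have vs := s's _ vs'.
rewrite /t mulrDr mulrDl !mulrA.
have -> : adjo a * v * adjo v0 * b = 0.
  case/nandP: n1 => h; first by rewrite (frame_orth fs as_ vs h) !mul0r.
  by rewrite -mulrA (frame_orth fs v0s' bs) ?mulr0// eq_sym.
rewrite add0r; apply/eqP; case/nandP: n2 => h.
  by rewrite (frame_orth fs as_ v0s' h) !mul0r.
by rewrite -mulrA (frame_orth fs vs bs) ?mulr0// eq_sym.
Qed.

End Generators.

(** * From generators of the factor to generators of a corner *)

Section Compressions.
Context {R : realType} {H : completeNormedModType R[i]}.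
Context {ip : {dot H for (@Num.conj R[i])}}.
Hypothesis ip_norm : forall u : H, ip u u = `|u| ^+ 2.
Local Notation bop := (bop ip).
Implicit Types (x y z v w e q : bop) (f : H -> H) (N : set (H -> H)).
Implicit Types (g : bop -> bop -> bop -> bop) (s : seq bop) (X P : {fset H -> H}).
Context {M : set (H -> H)} {tau : (H -> H) -> R[i]}.
Hypothesis M_II1 : II1_factor ip M.
Hypothesis tau_trace : normal_faithful_trace ip M tau.

Let Mb : set bop := [set x : bop | M x].
Let taub : bop -> R[i] := fun x => tau x.
Let vM : vN_algebra ip M := II1_vN M_II1.
Let F : traced_factor Mb taub := II1_traced_factor ip_norm M_II1 tau_trace.

Context {k : nat} {p : bop}.
Hypothesis k_gt0 : (0 < k)%N.
Hypothesis Mp : M p.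
Hypothesis pp : is_proj p.
Hypothesis tp : complex.Re (tau p) = k%:R^-1.

Local Notation frame := (@frame _ _ ip Mb p).

(** [g] chooses what represents a cell: the entry itself, or a real or imaginary part. Only cells
    with a nonzero entry are kept, so the length does not depend on [g]. *)
Definition compr_seq g s x : seq (H -> H) :=
  [seq bval (g x vw.1 vw.2) | vw <- [seq vw <- [seq (v, w) | v <- s, w <- s]
    | adjo vw.1 * x * vw.2 != 0]].

Lemma size_compr_seq g s x : size (compr_seq g s x) = ncompr s x.
Proof.
rewrite size_map size_filter -sum1_count big_mkcond big_allpairs.
by do 2?[apply: eq_bigr => ? _]; case: ifP.
Qed.

Definition compressions g s X : {fset H -> H} :=
  [fset h in flatten [seq compr_seq g s (tobop f) | f <- X]]%fset.

Lemma compressionsP g s X (h : H -> H) :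
  reflect (exists f v w, [/\ f \in X, v \in s, w \in s,
      adjo v * tobop f * w != 0 & h = g (tobop f) v w :> (H -> H)])
    (h \in compressions g s X).
Proof.
rewrite mem_fseq; apply: (iffP flattenP) => [[_ /mapP[f fX ->]]|].
  move=> /mapP[[v w]]; rewrite mem_filter => /andP[n0 /allpairsP[[v' w']]].
  by move=> [vs ws [? ?]] hE; subst; exists f, v', w'.
move=> [f [v [w [fX vs ws n0 ->]]]]; exists (compr_seq g s (tobop f)).
  exact: map_f.
apply/mapP; exists (v, w) => //; rewrite mem_filter n0/=.
by apply/allpairsP; exists (v, w).
Qed.

Lemma card_compressions g s X :
  (#|` compressions g s X| <= \sum_(f <- X) ncompr s (tobop f))%N.
Proof.
rewrite (perm_size (enum_fseq _)).
apply: leq_trans (size_undup _) _; rewrite size_flatten /shape -map_comp sumnE.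
by rewrite big_map; apply: leq_sum => f _; rewrite /= size_compr_seq.
Qed.

(** The last hypothesis says that the representatives chosen by [g] recover all entries inside any
    von Neumann algebra. *)
Lemma compressions_generate g s X :
  generates ip M X -> frame s -> span_proj s = 1 -> size s = k ->
  (forall f v w, f \in X -> v \in s -> w \in s -> corner M p (g (tobop f) v w)) ->
  (forall N, vN_algebra ip N ->
    (forall f v w, f \in X -> v \in s -> w \in s ->
      adjo v * tobop f * w != 0 -> N (g (tobop f) v w)) ->
    forall f v w, f \in X -> v \in s -> w \in s -> N (adjo v * tobop f * w)) ->
  generates ip (corner M p) (compressions g s X).
Proof.
move=> [XM WX] fs ss sz gc gN.
have vc := corner_vN vM Mp pp.
have Yc : [set` compressions g s X] `<=` corner M p.
  by move=> _ /= /compressionsP[f [v [w [fX vs ws _ ->]]]]; exact: gc.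
split=> //; apply/seteqP; split; first exact: W_star_min.
have vN := W_star_vN vc Yc; set N := W_star ip _ in vN *.
have MN : M `<=` [set f | M f /\
    forall v w, v \in s -> w \in s -> N (adjo v * tobop f * w)].
  rewrite -{1}WX; apply: W_star_min.
    by apply: vN_compress => // x y _ _; rewrite ss mulr1.
  move=> f fX; split; first exact: XM.
  move=> v w vs ws; apply: gN => // f' v' w' f'X v's w's n0.
  by apply: sub_W_star; apply/compressionsP; exists f', v', w'.
move=> f cf; rewrite -(vN_tobop vc cf).
have [My py] : M (tobop f : bop) /\ p * tobop f * p = tobop f.
  by have := (cornerE vM Mp pp (tobop f)).1; rewrite (vN_tobop vc cf) => /(_ cf).
(* An element y of pMp is itself a compression: y = v' (v y v') v for any v in the frame. *)
have vs : nth 0 s 0 \in s by rewrite mem_nth// sz.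
move: (nth 0 s 0) vs => v vs; have [Mv vp] := fs.1 _ vs.
have Mx : M (v * tobop f * adjo v).
  by apply: (vNM vM); [exact: (vNM vM)|exact: (vNA vM)].
have [_ /(_ v v vs vs)] := MN _ Mx.
by rewrite bvalK !mulrA vp -!mulrA vp !mulrA py.
Qed.

Lemma corner_compress x v w : M x -> M v -> M w ->
  adjo v * v = p -> adjo w * w = p ->
  M (adjo v * x * w) /\ p * (adjo v * x * w) * p = adjo v * x * w.
Proof.
move=> Mx Mv Mw vp wp; split.
  by apply: (vNM vM) => //; apply: (vNM vM) => //; exact: (vNA vM).
rewrite !mulrA -{1}pp.2 -adjoM (frame_source pp vp).
by rewrite -!mulrA (frame_source pp wp).
Qed.

Lemma compressions_bound g s1 s2 X P :
  generates ip M X -> projection_partition ip M P ->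
  frame (s1 ++ s2) -> size (s1 ++ s2) = k ->
  (forall v, v \in s1 -> exists2 q, q \in [seq tobop f : bop | f <- P] & q * v = v) ->
  (size s2 <= #|` P|)%N ->
  (#|` compressions g (s1 ++ s2) X|%:R <= indexI_at tau X P * k%:R ^+ 2
    + 2 * (#|` P|%:R * #|` X|%:R) * k%:R :> R).
Proof.
move=> [XM _] [hP _ _] fs sz h1 h2; set L := [seq tobop f : bop | f <- P] in h1.
have hL q : q \in L -> Mb q /\ is_proj q.
  by move=> /mapP[f fP ->]; have [Mf pf] := hP _ fP; exact: (tobop_proj M_II1 Mf pf).
have sL : size L = #|` P| by rewrite size_map.
have step f : f \in X -> (ncompr (s1 ++ s2) (tobop f))%:R <=
    indexI1 tau f P * k%:R ^+ 2 + 2 * (#|` P| * k)%:R.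
  move=> fX; have Mf := XM _ fX.
  have := count_compressions F k_gt0 pp tp (tobop f) hL fs sz h1.
  rewrite sL => /(_ h2); congr (_ <= _ * _ + _).
  rewrite /L big_map big_seq /indexI1 [RHS]big_seq; apply: eq_bigr => q qP.
  have tq f' : f' \in P -> rtau (tau := taub) (tobop f') = complex.Re (tau f').
    by move=> /hP[Mf' _]; rewrite /rtau /taub (vN_tobop vM Mf').
  rewrite big_map big_seq_cond [RHS]big_seq_cond; apply: eq_big => [q'|q' /andP[q'P _]].
    apply: andb_id2l => q'P; rewrite -bval_eq0.
    by rewrite /= (vN_tobop vM Mf) (vN_tobop vM (hP _ qP).1) (vN_tobop vM (hP _ q'P).1).
  by rewrite !tq.
apply: (@le_trans _ _ (\sum_(f <- X) (ncompr (s1 ++ s2) (tobop f))%:R)).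
  by rewrite -natr_sum ler_nat; exact: card_compressions.
apply: (@le_trans _ _ (\sum_(f <- X)
  (indexI1 tau f P * k%:R ^+ 2 + 2 * (#|` P| * k)%:R))).
  by rewrite big_seq [leRHS]big_seq; exact: ler_sum.
rewrite big_split/= -mulr_suml lerD2l.
rewrite big_const_seq count_predT iter_addr addr0 -[leLHS]mulr_natl natrM.
rewrite mulrCA -[leRHS]mulrA.
have h (a b c : R) : a * (b * c) = b * a * c by rewrite mulrCA mulrA.
by rewrite [X in 2 * X <= _](h _ _ _).
Qed.

Lemma generators_of_corner X P :
  generates ip M X -> projection_partition ip M P ->
  exists Y : {fset H -> H}, [/\ generates ip (corner M p) Y,
    (forall f, f \in X -> is_adjoint ip f f) ->
      forall f, f \in Y -> is_adjoint ip f f &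
    (#|` Y|%:R <= indexI_at tau X P * k%:R ^+ 2
      + 2 * (#|` P|%:R * #|` X|%:R) * k%:R :> R)].
Proof.
move=> gX pP; have [hP oP sP] := pP; have [XM _] := gX.
pose L := [seq tobop f : bop | f <- P].
have hL q : q \in L -> Mb q /\ is_proj q.
  by move=> /mapP[f fP ->]; have [Mf pf] := hP _ fP; exact: (tobop_proj M_II1 Mf pf).
have oL : pairwise (fun q q' => q * q' == 0) L.
  rewrite pairwise_map; have := fset_uniq P; rewrite uniq_pairwise.
  apply: (sub_in_pairwise _ (allss P)) => f f' fP f'P ff'.
  rewrite /= -bval_eq0 /= (vN_tobop vM (hP _ fP).1) (vN_tobop vM (hP _ f'P).1).
  by rewrite oP.
have sL : \sum_(q <- L) q = 1.
  apply: bop_ext => u; rewrite bsumE big_map -[RHS]sP big_seq [RHS]big_seq.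
  by apply: eq_bigr => f fP; rewrite (vN_tobop vM (hP _ fP).1).
have [s1 [s2 [fs ss sz h1 h2]]] := frame_partition ip_norm F k_gt0 Mp pp tp hL oL sL.
rewrite size_map in h2; set s := s1 ++ s2 in fs ss sz.
have Ms v : v \in s -> M v /\ adjo v * v = p by exact: fs.1.
have MX f : f \in X -> M (tobop f : bop) by move=> /XM Mf; rewrite (vN_tobop vM Mf).
have cc f v w : f \in X -> v \in s -> w \in s -> M (adjo v * tobop f * w) /\
    p * (adjo v * tobop f * w) * p = adjo v * tobop f * w.
  move=> fX /Ms[Mv vp] /Ms[Mw wp]; apply: corner_compress => //; exact: MX.
(* If [X] is not self-adjoint, the second claim is vacuous and plain compressions serve. *)
have [Xsa|Xsa] := pselect (forall f, f \in X -> is_adjoint ip f f); last first.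
  pose g x v w := adjo v * x * w.
  exists (compressions g s X); split=> //.
    apply: compressions_generate => // [f v w fX vs ws|N vN h f v w fX vs ws].
      by apply/(cornerE vM Mp pp); exact: cc.
    by have [->|n0] := eqVneq (adjo v * tobop f * w) 0; [exact: vN0|exact: h].
  exact: compressions_bound.
pose a x v w := adjo v * x * w.
(* Cells (v, w) and (w, v) hold adjoint entries, nonzero together. One cell receives twice the real
   part, the other a multiple of the imaginary part, so the count is unchanged; diagonal entries are
   already self-adjoint. *)
pose g x v w := if v == w then a x v w
  else if (index v s < index w s)%N then a x v w + adjo (a x v w)
  else 'i *: (a x v w - adjo (a x v w)).
have xsa f : f \in X -> adjo (tobop f : bop) = tobop f.
  by move=> fX; apply: adjo_uniq; rewrite (vN_tobop vM (XM _ fX)); exact: Xsa.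
have asa f v w : f \in X -> adjo (a (tobop f) v w) = a (tobop f) w v.
  by move=> /xsa xa; rewrite /a !adjoM adjoK xa mulrA.
have ii : 'i * 'i = -1 :> R[i] by rewrite -expr2 sqr_i.
exists (compressions g s X); split=> //; last exact: compressions_bound.
  apply: compressions_generate => // [f v w fX vs ws|N vN h f v w fX vs ws].
    have vc := corner_vN vM Mp pp.
    have ca v' w' : v' \in s -> w' \in s -> corner M p (a (tobop f) v' w').
      by move=> vs' ws'; apply/(cornerE vM Mp pp); exact: cc.
    rewrite /g asa//; case: ifP => _; first exact: ca.
    case: ifP => _; first by apply: (vND vc); exact: ca.
    by apply: (vNZ vc); apply: (vNB vc); exact: ca.
  have lt_case v' w' : v' \in s -> w' \in s -> (index v' s < index w' s)%N ->
      N (a (tobop f) v' w').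
    move=> vs' ws' vw; have [->|n0] := eqVneq (a (tobop f) v' w') 0; first exact: vN0.
    have nvw : v' != w' by apply: contraTneq vw => ->; rewrite ltnn.
    have h1' := h f v' w' fX vs' ws' n0.
    have n0' : a (tobop f) w' v' != 0.
      by apply: contraNneq n0 => h0; rewrite -asa// h0 adjo0.
    have h2' := h f w' v' fX ws' vs' n0'.
    rewrite /g (negPf nvw) vw in h1'.
    rewrite /g eq_sym (negPf nvw) ltnNge (ltnW vw)/= in h2'.
    have : N (2^-1 *: (a (tobop f) v' w' + adjo (a (tobop f) v' w') +
        'i *: ('i *: (a (tobop f) w' v' - adjo (a (tobop f) w' v'))))).
      by apply: (vNZ vN); apply: (vND vN) => //; exact: (vNZ vN).
    rewrite scalerA ii scaleN1r opprB !asa// addrACA subrr addr0.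
    rewrite scalerDr -scalerDl; have -> : 2^-1 + 2^-1 = 1 :> R[i].
      by rewrite [RHS]splitr !mul1r.
    by rewrite scale1r.
  have [vw|wv|vw] := ltngtP (index v s) (index w s).
  - exact: lt_case.
  - by rewrite -[adjo v * _ * w]adjoK; apply: (vNA vN); rewrite asa//; exact: lt_case.
  - have {}vw : v = w by rewrite -(nth_index 0 vs) vw nth_index.
    have [->|n0] := eqVneq (adjo v * tobop f * w) 0; first exact: vN0.
    by have := h f v w fX vs ws n0; rewrite /g vw eqxx.
move=> _ f /compressionsP[f0 [v [w [fX vs ws _ ->]]]].
suff {2}<- : adjo (g (tobop f0) v w) = g (tobop f0) v w by exact: adjoP.
rewrite /g; case: eqP => [->|_]; first by rewrite asa.
case: ifP => _; first by rewrite adjoD adjoK addrC.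
by rewrite adjoZ adjoB adjoK -[RHS]opprK -scalerN -scaleNr opprB; congr (_ *: _);
  apply/eqP; rewrite eq_complex/= oppr0 !eqxx.
Qed.

End Compressions.

(** * The limit *)

(** The constant C may depend on z, as it must when a is an infimum: a better approximation of a
    costs a larger error term. *)
Lemma ereal_squeeze (R : realType) (a : \bar R) (b : nat -> \bar R) (c : R) :
  (0 <= a)%E ->
  (forall k, (0 < k)%N -> (a <= b k + (c / k%:R)%:E)%E) ->
  (forall z : R, (a < z%:E)%E -> exists C : R, forall k, (0 < k)%N ->
    (b k <= (z + C / k%:R)%:E)%E) ->
  b @ \oo --> a.
Proof.
case: a => [r|_ h _|//]; last first.
  (* For a = +oo the lower bound forces [b k] = +oo for every k > 0. *)
  apply: cvg_near_cst; exists 1%N => // k /= k0.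
  have := h k k0; rewrite leye_eq; case: (b k) => //.
move=> r0 h1 h2.
have [|C0 hC0] := h2 (r + 1); first by rewrite lte_fin ltrDl.
have bfin k : (0 < k)%N -> b k \is a fin_num.
  move=> k0; move: (h1 k k0) (hC0 k k0); by case: (b k).
apply/fine_cvgP; split; first by exists 1%N => // k /= k0; exact: bfin.
apply/cvgrPdist_lt => e e0.
have e2 : 0 < e / 2 by rewrite divr_gt0.
have [C hC] : exists C : R, forall k, (0 < k)%N -> (b k <= (r + e / 2 + C / k%:R)%:E)%E.
  by apply: h2; rewrite lte_fin ltrDl.
pose D := `|c| + `|C|.
exists (Num.bound (D / (e / 2))).+1 => // k /= hk.
have k0 : (0 < k)%N by exact: leq_ltn_trans hk.
have kR : 0 < k%:R :> R by rewrite ltr0n.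
have Dk : D / k%:R < e / 2.
  rewrite ltr_pdivrMr// mulrC -ltr_pdivrMr//.
  apply: lt_trans (archi_boundP _) _; last by rewrite ltr_nat.
  by apply: divr_ge0; [rewrite /D addr_ge0|exact: ltW].
have le_D x : `|x| <= D -> x / k%:R < e / 2.
  move=> xD; apply: le_lt_trans Dk; rewrite ler_pM2r ?invr_gt0//.
  exact: le_trans (ler_norm _) xD.
have bk : b k = (fine (b k))%:E by rewrite fineK// bfin.
have := hC k k0; have := h1 k k0; rewrite bk -EFinD !lee_fin /= => lo up.
have hc : c / k%:R < e / 2 by apply: le_D; rewrite lerDl.
have hCk : C / k%:R < e / 2 by apply: le_D; rewrite lerDr.
rewrite ltr_norml; apply/andP; split.
  rewrite ltrBrDl ltrBlDr; apply: le_lt_trans up _.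
  by rewrite [e in ltRHS]splitr addrA ltrD2l.
rewrite ltrBlDl; apply: le_lt_trans lo _.
rewrite ltrD2l; apply: lt_trans hc _.
by rewrite [ltRHS]splitr ltrDl.
Qed.

Section Limits.
Context {R : realType} {H : completeNormedModType R[i]}.
Context {ip : {dot H for (@Num.conj R[i])}}.
Hypothesis ip_norm : forall u : H, ip u u = `|u| ^+ 2.
Context {M : set (H -> H)} {tau : (H -> H) -> R[i]}.
Hypothesis M_II1 : II1_factor ip M.
Hypothesis tau_trace : normal_faithful_trace ip M tau.

(** Abstract families of generating sets let the same argument give both limits. *)
Lemma limit_of_bounds (GM : set {fset H -> H}) (GC : nat -> set {fset H -> H}) :
  (forall k Y, (0 < k)%N -> GC k Y -> exists2 X, GM X & (indexI ip M tau X <=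
      ((#|` Y|%:R + 2 * k%:R) / k%:R ^+ 2 : R)%:E)%E) ->
  (forall k X P, (0 < k)%N -> GM X -> projection_partition ip M P ->
    exists2 Y, GC k Y & #|` Y|%:R <= indexI_at tau X P * k%:R ^+ 2
      + 2 * (#|` P|%:R * #|` X|%:R) * k%:R :> R) ->
  (fun k : nat => (ereal_inf [set (#|` Y|%:R : R)%:E | Y in GC k]
      * ((k%:R ^+ 2)^-1 : R)%:E)%E) @ \oo -->
    ereal_inf [set indexI ip M tau X | X in GM].
Proof.
move=> hA hB; apply: (@ereal_squeeze _ _ _ 2).
- apply: le_ereal_inf_tmp => _ [X _ <-]; apply: le_ereal_inf_tmp => _ [P hP <-].
  rewrite lee_fin; apply: sumr_ge0 => f _; exact: (indexI1_ge0 ip_norm M_II1 tau_trace).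
- move=> k k0.
  have kR : 0 < k%:R :> R by rewrite ltr0n.
  have k2 : 0 < (k%:R ^+ 2)^-1 :> R by rewrite invr_gt0 exprn_gt0.
  set m := ereal_inf [set _ | Y in GC k].
  have m0 : (0 <= m)%E by apply: le_ereal_inf_tmp => _ [Y _ <-]; rewrite lee_fin.
  case mE : m m0 => [r| |] // r0; last by rewrite gt0_mulye ?lte_fin// addye// leey.
  (* The infimum m is approached within e k^2, which becomes e after division by k^2. *)
  apply/lee_addgt0Pr => e e0.
  have e1 : 0 < e * k%:R ^+ 2 by rewrite mulr_gt0// exprn_gt0.
  have : (m < (r + e * k%:R ^+ 2)%:E)%E by rewrite mE lte_fin ltrDl.
  move=> /ereal_inf_lt[_ [Y gY <-]]; rewrite lte_fin => hY.
  have [X gX hX] := hA k Y k0 gY.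
  apply: (@le_trans _ _ (indexI ip M tau X)).
    by apply: ereal_inf_lbound; exists X.
  apply: le_trans hX _; rewrite -EFinM -!EFinD lee_fin mulrDl addrAC.
  have -> : 2 * k%:R / k%:R ^+ 2 = 2 / k%:R :> R.
    by rewrite expr2 invfM mulrA mulrK// unitfE gt_eqF.
  rewrite lerD2r -[e](@mulfK _ (k%:R ^+ 2)) ?gt_eqF ?exprn_gt0//.
  by rewrite -mulrDl ler_pM2r// ltW.
move=> z /ereal_inf_lt[_ [X gX <-]] /ereal_inf_lt[_ [P hP <-]].
rewrite lte_fin => hz; exists (2 * (#|` P|%:R * #|` X|%:R)) => k k0.
have kR : 0 < k%:R :> R by rewrite ltr0n.
have k2 : 0 < (k%:R ^+ 2)^-1 :> R by rewrite invr_gt0 exprn_gt0.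
have [Y gY hY] := hB k X P k0 gX hP.
apply: (@le_trans _ _ ((#|` Y|%:R : R)%:E * ((k%:R ^+ 2)^-1 : R)%:E)%E).
  rewrite lee_pmul2r ?lte_fin//; apply: ereal_inf_lbound; by exists Y.
rewrite -EFinM lee_fin ler_pdivrMr ?exprn_gt0// mulrDl.
apply: le_trans hY _; apply: lerD; first by rewrite ler_pM2r ?exprn_gt0// ltW.
by rewrite expr2 [leRHS]mulrA divfK// gt_eqF.
Qed.

End Limits.

Unset Implicit Arguments.

Theorem corollary5p11 (R : realType) (H : completeNormedModType R[i])
    (ip : {dot H for (@Num.conj R[i])})
    (ip_norm : forall u : H, ip u u = `|u| ^+ 2)
    (M : set (H -> H)) (tau : (H -> H) -> R[i])
    (M_II1 : II1_factor ip M)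
    (M_sep : separable_predual ip M)
    (tau_trace : normal_faithful_trace ip M tau)
    (p : nat -> H -> H)
    (p_proj : forall k : nat, (0 < k)%N ->
       [/\ M (p k), projection ip (p k) & tau (p k) = (k%:R)^-1]) :
  ((fun k : nat => (calGmin ip (corner M (p k)) * ((k%:R ^+ 2)^-1 : R)%:E)%E)
     @ \oo --> calG ip M tau) /\
  ((fun k : nat => (calGmin_sa ip (corner M (p k)) * ((k%:R ^+ 2)^-1 : R)%:E)%E)
     @ \oo --> calG_sa ip M tau).
Proof.
have vM := II1_vN M_II1.
pose q k : bop ip := tobop (p k).
have qE k : (0 < k)%N -> [/\ p k = q k :> (H -> H), M (q k), is_proj (q k) &
    complex.Re (tau (q k)) = k%:R^-1].
  move=> /p_proj[Mp pp tp]; have [Mq pq] := tobop_proj M_II1 Mp pp.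
  have qp : q k = p k :> (H -> H) by rewrite /q (vN_tobop vM Mp).
  split=> //.
  by rewrite qp tp -(rmorph_nat (real_complex R)) -fmorphV.
split; apply: (limit_of_bounds ip_norm M_II1 tau_trace).
- move=> k Y k0; have [-> Mq pq tq] := qE k k0.
  move=> /(corner_generators ip_norm M_II1 tau_trace k0 Mq pq tq)[X [gX _ hX]].
  by exists X.
- move=> k X P k0 gX hP; have [-> Mq pq tq] := qE k k0.
  have [Y [gY _ hY]] := generators_of_corner ip_norm M_II1 tau_trace k0 Mq pq tq gX hP.
  by exists Y.
- move=> k Y k0; have [-> Mq pq tq] := qE k k0 => -[gY saY].
  have [X [gX saX hX]] := corner_generators ip_norm M_II1 tau_trace k0 Mq pq tq gY.
  by exists X => //; split=> //; exact: saX.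
- move=> k X P k0 [gX saX] hP; have [-> Mq pq tq] := qE k k0.
  have [Y [gY saY hY]] := generators_of_corner ip_norm M_II1 tau_trace k0 Mq pq tq gX hP.
  by exists Y => //; split=> //; exact: saY.
Qed.
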